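(* Let $W:[0,T]\times\Omega\to H$ be a zero-mean $H$-valued Gaussian process with covariance operator $Q_W:[0,T]^2\to\mathcal{L}(H)$, and assume that $t\mapsto W(t,\omega)$ is $\beta$-Hölder continuous with $\beta\in(0,1)$ for every $\omega\in\mathcal{N}^c\in\mathcal{F}$, where $\mathcal{N}^c$ has full measure. Let $K\in\mathcal{K}_\eta$ with $\beta-\eta>0$, and suppose $Q_W\in\mathcal{Q}_\alpha$ with $\alpha-\eta>0$. For $\omega\in\mathcal{N}^c$ let $$X^\tau(t,\omega)=\int_0^tK(\tau,s)\,dW(s,\omega),\qquad (\tau,t)\in\Delta_2^T,$$ be the pathwise Volterra integral. Then $(t,\omega)\mapsto X^t(t,\omega)$ is an $H$-valued zero-mean Gaussian process on $(\Omega,\mathcal{F},\mathbb{P})$, and for every $(\tau,t)\in\Delta_2^T$ and every $f\in H$, $$\mathbb{E}\big[\exp\big(i\langle X^\tau(t),f\rangle_H\big)\big]=\exp\Big(-\tfrac12\Big\langle\int_0^t\int_0^tK(\tau,r)\,d^2Q_W(r,r')\,K(\tau,r')^*f,f\Big\rangle_H\Big).$$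
   Context: $(\Omega,\mathcal{F},\mathbb{P})$ is a complete probability space, $T>0$, $H$ a separable real Hilbert space, $\mathcal{L}(H)$ the bounded linear operators on $H$ with operator norm $\|\cdot\|_{op}$, $^*$ the adjoint, $\Delta_2^T=\{(t,s)\in[0,T]^2:t\ge s\}$. An $H$-valued random variable $X$ is Gaussian if $\langle X,h\rangle_H$ is a real Gaussian variable for all $h\in H$; an $H$-valued process is Gaussian if all vectors $(X(t_1),\dots,X(t_n))$ are $H^n$-valued Gaussian random variables. The covariance operator of a zero-mean $H$-valued Gaussian process $W$ is $Q_W(s,t)\in\mathcal{L}(H)$ determined by $\langle Q_W(s,t)g,h\rangle_H=\mathbb{E}[\langle W(t),g\rangle_H\langle W(s),h\rangle_H]$ for $g,h\in H$. Rectangular increment: $\square_{(s,s'),(t,t')}f=f(t,t')-f(t,s')-f(s,t')+f(s,s')$. Kernels: for $\eta\in(0,1)$, $\mathcal{K}_\eta$ is the space of maps $K:\Delta_2^T\to\mathcal{L}(H)$ with $\|K\|_{\mathcal{K}_\eta}:=\sum_{i=1}^4\|K\|_{\eta,i}<\infty$, where $\|K\|_{\eta,1}=\sup_{t>s}\frac{\|K(t,s)\|_{op}}{|t-s|^{-\eta}}$, $\|K\|_{\eta,2}=\sup_{t>u>s,\ \theta\in[0,1]}\frac{\|K(t,s)-K(u,s)\|_{op}}{|t-u|^\theta|u-s|^{-\theta-\eta}}$, $\|K\|_{\eta,3}=\sup_{t>u>s,\ \theta\in[0,1]}\frac{\|K(t,u)-K(t,s)\|_{op}}{|u-s|^\theta|t-u|^{-\theta-\eta}}$,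 $\|K\|_{\eta,4}=\sup_{\tau'>\tau>s>r,\ \theta,\nu\in[0,1]}\frac{\|K(\tau',s)-K(\tau',r)-K(\tau,s)+K(\tau,r)\|_{op}}{|\tau-s|^{-\nu-\theta-\eta}|\tau'-\tau|^\nu|s-r|^\theta}$ (all times in $[0,T]$; values on the diagonal play no role). Regular covariance operators: for $\alpha\in(0,1)$, $\mathcal{Q}_\alpha$ is the class of $Q:[0,T]^2\to\mathcal{L}(H)$ with finite $\|Q\|_{\mathcal{Q}_\alpha}$, the sum of $\sup_{t>s,\,t'}\frac{\|Q(t,t')-Q(s,t')\|_{op}}{|t-s|^\alpha}$, $\sup_{t,\,t'>s'}\frac{\|Q(t,t')-Q(t,s')\|_{op}}{|t'-s'|^\alpha}$ and $\sup_{t>s,\,t'>s'}\frac{\|\square_{(s,s'),(t,t')}Q\|_{op}}{(|t-s||t'-s'|)^\alpha}$. Pathwise Volterra integral: $\int_0^tK(\tau,s)dW(s):=\lim_{|\mathcal{P}|\to0}\sum_{[u,v]\in\mathcal{P}}K(\tau,u)(W(v)-W(u))$, limit in $H$ over partitions $\mathcal{P}$ of $[0,t]$ with mesh $|\mathcal{P}|$ (it exists for $\beta$-Hölder paths when $\beta>\eta$). The double integral $\int_0^t\int_0^{t}K(\tau,r)d^2Q(r,r')K(\tau,r')^*$ is the operator-norm limit, as the meshes of partitions $\mathcal{P},\mathcal{P}'$ of $[0,t]$ tend to $0$, of $\sum_{[u,v]\in\mathcal{P},[u',v']\in\mathcal{P}'}K(\tau,u)\,\square_{(u,u'),(v,v')}Q\,K(\tau,u')^*$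 (it exists when $\alpha>\eta$). *)

(* Defs.v *)
From HB Require Import structures.
From mathcomp Require Import all_boot all_order all_algebra.
From mathcomp Require Import sesquilinear complex.
From mathcomp Require Import all_classical all_reals all_analysis.

Set Implicit Arguments.
Unset Strict Implicit.
Unset Printing Implicit Defensive.

Import Order.TTheory GRing.Theory Num.Theory.
Import numFieldNormedType.Exports.

Local Open Scope classical_set_scope.
Local Open Scope ring_scope.

HB.mixin Record CompleteNormedModule_isHilbert (R : realType) H
    & CompleteNormedModule R H := {
  inner : {dot H for (@idfun R)};
  inner_normE : forall x : H, inner x x = `|x| ^+ 2
}.

#[short(type="hilbertType")]
HB.structure Definition Hilbert (R : realType) :=
  {H of CompleteNormedModule_isHilbert R H & CompleteNormedModule R H}.

Definition separable (T : topologicalType) :=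
  exists2 D : set T, countable D & dense D.

Section bounded_linear_operators.
Context (R : realType) (V : normedModType R).

Definition bounded_linear : {pred V -> V} := fun f =>
  `[< linear f /\ exists M, forall x, `|f x| <= M * `|x| >].

Lemma bounded_linear_submod : submod_closed bounded_linear.
Proof.
split=> [|a f g /asboolP[lf [M fM]] /asboolP[lg [N gN]]]; apply/asboolP; split.
- by move=> a x y; rewrite /GRing.zero /= scaler0 addr0.
- by exists 0 => x; rewrite /GRing.zero /= normr0 mul0r.
- have fgE z : (a *: f + g) z = a *: f z + g z by [].
  by move=> b x y; rewrite !fgE lf lg !scalerDr !scalerA (mulrC a b) addrACA.
- exists (`|a| * M + N) => x; rewrite [X in `|X|]/(a *: f x + g x).
  rewrite (le_trans (ler_normD _ _))// normrZ mulrDl lerD// -mulrA.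
  by rewrite ler_wpM2l.
Qed.
HB.instance Definition _ :=
  GRing.isSubmodClosed.Build R (V -> V) bounded_linear bounded_linear_submod.

Record boundedOp := BoundedOp {
  boundedOp_fun :> V -> V ;
  boundedOpP : boundedOp_fun \in bounded_linear }.
HB.instance Definition _ := [isSub for boundedOp_fun].
HB.instance Definition _ := [Choice of boundedOp by <:].
HB.instance Definition _ := [SubChoice_isSubLmodule of boundedOp by <:].

Implicit Types A B : boundedOp.

Lemma boundedOp_linear A : linear A.
Proof. by have /asboolP[] := boundedOpP A. Qed.

Lemma boundedOp_bounded A : exists M, forall x, `|A x| <= M * `|x|.
Proof. by have /asboolP[] := boundedOpP A. Qed.

Lemma boundedOpDE A B x : (A + B) x = A x + B x. Proof. by []. Qed.

Lemma boundedOpZE a A x : (a *: A) x = a *: A x. Proof. by []. Qed.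

Definition opnorm A : R := sup [set `|A x| | x in [set x : V | `|x| <= 1]].

Let opnorm_has_sup A : has_sup [set `|A x| | x in [set x : V | `|x| <= 1]].
Proof.
split; first by exists `|A 0|, 0 => //=; rewrite normr0.
have [M AM] := boundedOp_bounded A; exists `|M| => _ [x /= x1 <-].
rewrite (le_trans (AM x))// (le_trans (ler_norm _))// normrM normr_id.
by rewrite ler_piMr.
Qed.

Let opnorm_ub A x : `|x| <= 1 -> `|A x| <= opnorm A.
Proof.
by move=> x1; apply: ub_le_sup; [case: (opnorm_has_sup A)|exists x].
Qed.

Let opnorm_ge0 A : 0 <= opnorm A.
Proof. by apply: le_trans (opnorm_ub A (x := 0) _); rewrite ?normr0. Qed.

Let boundedOp0 A : A 0 = 0.
Proof. by have := boundedOp_linear A (-1) 0 0; rewrite scaler0 addr0 scaleN1r addNr. Qed.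

Let boundedOpZ A a x : A (a *: x) = a *: A x.
Proof. by have := boundedOp_linear A a x 0; rewrite boundedOp0 !addr0. Qed.

Lemma le_opnorm A x : `|A x| <= opnorm A * `|x|.
Proof.
have [->|x0] := eqVneq x 0; first by rewrite boundedOp0 !normr0 mulr0.
have nx0 : 0 < `|x| by rewrite normr_gt0.
rewrite -ler_pdivrMr//.
have -> : `|A x| / `|x| = `|A (`|x|^-1 *: x)|.
  by rewrite boundedOpZ normrZ normfV normr_id mulrC.
by apply: opnorm_ub; rewrite normrZ normfV normr_id mulVf// gt_eqF.
Qed.

Let opnorm_le A M : (forall x, `|x| <= 1 -> `|A x| <= M) -> opnorm A <= M.
Proof.
move=> AM; apply: ge_sup => [|_ [x /= x1 <-]]; last exact: AM.
by case: (opnorm_has_sup A).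
Qed.

Let opnormD A B : opnorm (A + B) <= opnorm A + opnorm B.
Proof.
apply: opnorm_le => x x1; rewrite boundedOpDE (le_trans (ler_normD _ _))//.
by rewrite lerD// opnorm_ub.
Qed.

Let opnormZ a A : opnorm (a *: A) = `|a| * opnorm A.
Proof.
have leZ b B : opnorm (b *: B) <= `|b| * opnorm B.
  apply: opnorm_le => x x1; rewrite boundedOpZE normrZ.
  by rewrite ler_wpM2l// opnorm_ub.
apply/le_anti; rewrite leZ/=; have [->|a0] := eqVneq a 0.
  by rewrite normr0 mul0r opnorm_ge0.
rewrite -ler_pdivlMl ?normr_gt0// -normfV.
by apply: le_trans (leZ _ _); rewrite scalerA mulVf// scale1r.
Qed.

Let opnorm0_eq0 A : opnorm A = 0 -> A = 0.
Proof.
move=> A0; apply/val_inj/funext => x /=; apply/eqP.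
by rewrite -normr_le0; have := le_opnorm A x; rewrite A0 mul0r.
Qed.

HB.instance Definition _ :=
  Lmodule_isNormed.Build R boundedOp opnormD opnormZ opnorm0_eq0.

Lemma boundedOp_normE A :
  `|A| = sup [set `|A x| | x in [set x : V | `|x| <= 1]].
Proof. by []. Qed.

Lemma opcomp_subproof A B : A \o B \in bounded_linear.
Proof.
apply/asboolP; split=> [a x y /=|]; first by rewrite !boundedOp_linear.
exists (opnorm A * opnorm B) => x /=.
by rewrite (le_trans (le_opnorm _ _))// -mulrA ler_wpM2l// le_opnorm.
Qed.
Definition opcomp A B : boundedOp := BoundedOp (opcomp_subproof A B).

End bounded_linear_operators.

Section adjoint.
Context (R : realType) (H : hilbertType R).

(* The operator is unique by definiteness of [inner] and exists by the Riesz
   representation theorem. *)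
Definition adjoint (A : boundedOp H) : boundedOp H :=
  get [set B : boundedOp H | forall x y : H, inner (A x) y = inner x (B y)].

End adjoint.

Section gaussian.
Context (R : realType) (d : measure_display) (Omega : measurableType d).
Context (P : probability Omega R).

(* [normal_prob m 0] is not the Dirac mass at [m], hence the case analysis. *)
Definition real_gaussian (Y : Omega -> R) :=
  measurable_fun setT Y /\
  exists m sigma : R, forall A : set R, measurable A ->
    pushforward P Y A = if sigma == 0 then dirac m A else normal_prob m sigma A.

Context (H : hilbertType R).

Definition hilbert_rv (X : Omega -> H) :=
  measurable_fun setT (X : Omega -> g_sigma_algebraType (@open H)).

(* [\sum_i inner (X i w) (h i)] is the inner product of [H^n]; when [H] is
   separable, measurability of the vector is that of its components. *)
Definition gaussian_vector (n : nat) (X : 'I_n -> Omega -> H) :=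
  (forall i, hilbert_rv (X i)) /\
  forall h : 'I_n -> H, real_gaussian (fun w => \sum_(i < n) inner (X i w) (h i)).

Definition gaussian_process (D : set R) (X : R -> Omega -> H) :=
  forall (n : nat) (t : 'I_n -> R), (forall i, D (t i)) ->
    gaussian_vector (fun i => X (t i)).

(* Zero mean in the weak sense, which for Gaussian variables is the same as a
   vanishing Bochner expectation. *)
Definition zero_mean (D : set R) (X : R -> Omega -> H) :=
  forall (t : R) (h : H), D t -> ('E_P[fun w => inner (X t w) h] = 0)%E.

Definition covariance_operator (D : set R) (W : R -> Omega -> H)
    (Q : R -> R -> boundedOp H) :=
  forall (s t : R) (g h : H), D s -> D t ->
    (inner (Q s t g) h)%:E =
    ('E_P[fun w => (inner (W t w) g * inner (W s w) h)%R])%E.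

End gaussian.

Definition hoelder_on (R : realType) (V : normedModType R) (beta : R)
    (D : set R) (f : R -> V) :=
  exists M, forall s t, D s -> D t -> `|f t - f s| <= M * `|t - s| `^ beta.

(* [rect_incr f s s' t t'] is the increment of [f] over (s,s'),(t,t'). *)
Definition rect_incr (R : realType) (V : zmodType) (f : R -> R -> V)
    (s s' t t' : R) : V :=
  f t t' - f t s' - f s t' + f s s'.

Section classes.
Context (R : realType) (V : normedModType R).
Implicit Types (K Q : R -> R -> V).

(* A function on the triangle [0 <= s <= t <= T] is represented by a total
   function, of which the norms only see the values with [0 <= s < t <= T]. *)
Definition kernel_norm1 (T eta : R) K : \bar R := ereal_sup
  [set x | exists t s, [/\ 0 <= s, s < t, t <= T &
    x = (`|K t s| / `|t - s| `^ (- eta))%:E]].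

Definition kernel_norm2 (T eta : R) K : \bar R := ereal_sup
  [set x | exists t u s theta,
    [/\ [/\ 0 <= s, s < u, u < t & t <= T], 0 <= theta <= 1 &
    x = (`|K t s - K u s| /
         (`|t - u| `^ theta * `|u - s| `^ (- theta - eta)))%:E]].

Definition kernel_norm3 (T eta : R) K : \bar R := ereal_sup
  [set x | exists t u s theta,
    [/\ [/\ 0 <= s, s < u, u < t & t <= T], 0 <= theta <= 1 &
    x = (`|K t u - K t s| /
         (`|u - s| `^ theta * `|t - u| `^ (- theta - eta)))%:E]].

Definition kernel_norm4 (T eta : R) K : \bar R := ereal_sup
  [set x | exists tau' tau s r theta nu,
    [/\ [/\ 0 <= r, r < s, s < tau, tau < tau' & tau' <= T],
        0 <= theta <= 1, 0 <= nu <= 1 &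
    x = (`|K tau' s - K tau' r - K tau s + K tau r| /
         (`|tau - s| `^ (- nu - theta - eta) * `|tau' - tau| `^ nu *
          `|s - r| `^ theta))%:E]].

Definition kernel_norm (T eta : R) K : \bar R :=
  (kernel_norm1 T eta K + kernel_norm2 T eta K +
   kernel_norm3 T eta K + kernel_norm4 T eta K)%E.

Definition kernel_class (T eta : R) : set (R -> R -> V) :=
  [set K | (kernel_norm T eta K < +oo)%E].

Definition covariance_norm1 (T alpha : R) Q : \bar R := ereal_sup
  [set x | exists t s t', [/\ 0 <= s, s < t, t <= T, 0 <= t' <= T &
    x = (`|Q t t' - Q s t'| / `|t - s| `^ alpha)%:E]].

Definition covariance_norm2 (T alpha : R) Q : \bar R := ereal_sup
  [set x | exists t t' s', [/\ 0 <= s', s' < t', t' <= T, 0 <= t <= T &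
    x = (`|Q t t' - Q t s'| / `|t' - s'| `^ alpha)%:E]].

Definition covariance_norm3 (T alpha : R) Q : \bar R := ereal_sup
  [set x | exists t s t' s',
    [/\ [/\ 0 <= s, s < t & t <= T], [/\ 0 <= s', s' < t' & t' <= T] &
    x = (`|rect_incr Q s s' t t'| /
         (`|t - s| * `|t' - s'|) `^ alpha)%:E]].

Definition covariance_norm (T alpha : R) Q : \bar R :=
  (covariance_norm1 T alpha Q + covariance_norm2 T alpha Q +
   covariance_norm3 T alpha Q)%E.

Definition covariance_class (T alpha : R) : set (R -> R -> V) :=
  [set Q | (covariance_norm T alpha Q < +oo)%E].

End classes.

Section integrals.
Context (R : realType).

(* As in [itv_partition 0 t s], the partition [0 < s_0 < ... < s_{n-1} = t] is
   represented by the sequence [s] of its points other than [0]. *)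
Definition node (s : seq R) (i : nat) : R := nth 0 (0 :: s) i.

Definition mesh (s : seq R) : R :=
  \big[Num.max/0]_(i < size s) (node s i.+1 - node s i).

Definition mesh_to0 (t : R) : set_system (seq R) :=
  filter_from [set delta : R | 0 < delta]
    (fun delta => [set s | itv_partition 0 t s /\ mesh s < delta]).

Context (H : hilbertType R).
Implicit Types (K Q : R -> R -> boundedOp H).

Definition volterra_sum K (w : R -> H) (tau : R) (s : seq R) : H :=
  \sum_(i < size s) K tau (node s i) (w (node s i.+1) - w (node s i)).

Definition volterra_integral K (w : R -> H) (tau t : R) : H :=
  lim (volterra_sum K w tau s @[s --> mesh_to0 t]).

Definition double_sum K Q (tau : R) (s s' : seq R) : boundedOp H :=
  \sum_(i < size s) \sum_(j < size s')
    opcomp (opcomp (K tau (node s i))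
      (rect_incr Q (node s i) (node s' j) (node s i.+1) (node s' j.+1)))
      (adjoint (K tau (node s' j))).

Definition double_integral K Q (tau t : R) : boundedOp H :=
  lim (double_sum K Q tau p.1 p.2 @[p --> (mesh_to0 t, mesh_to0 t)]).

End integrals.

Section complex.
Local Open Scope complex_scope.
Context (R : realType).

Definition cexp (z : R[i]) : R[i] :=
  (expR (complex.Re z))%:C * (cos (complex.Im z) +i* sin (complex.Im z)).

(* Only meaningful when the real and imaginary parts of [Z] are integrable. *)
Definition cexpectation (d : measure_display) (Omega : measurableType d)
    (P : probability Omega R) (Z : Omega -> R[i]) : R[i] :=
  fine 'E_P[fun w => complex.Re (Z w)]%E +i*
    fine 'E_P[fun w => complex.Im (Z w)]%E.

End complex.

(* Main.v *)
Require Import Defs.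
From HB Require Import structures.
From mathcomp Require Import all_boot all_order all_algebra.
From mathcomp Require Import sesquilinear complex.
From mathcomp Require Import all_classical all_reals all_analysis.
From mathcomp Require Import measurable_realfun ring lra.

Set Implicit Arguments.
Unset Strict Implicit.
Unset Printing Implicit Defensive.

Import Order.TTheory GRing.Theory Num.Theory.
Import numFieldNormedType.Exports.

Local Open Scope classical_set_scope.
Local Open Scope ring_scope.

(** The Riemann sums of a pathwise Volterra integral telescope. Inserting a point
    [m] between the neighbours [u < v] of a partition changes the sum by
    [(K(tau,u) - K(tau,m)) (W(v) - W(m))]. Bounding the kernel increment by the
    better of its two Hoelder exponents [0] and [1], and the increment of [W] by
    [mesh^gamma (tau-m)^(eta+gamma)] with [beta = eta + 2 gamma], this is at most
    a constant times [mesh^gamma ((tau-u)^gamma - (tau-m)^gamma)], whose sum over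
    the inserted points is bounded: the sums are Cauchy as the mesh tends to 0.
    Applying the same estimate in each variable separately, with operator-valued
    paths, gives the convergence in operator norm of the double sums.

    A Riemann sum tested against a vector is a finite combination of values of
    [W], hence a centered real Gaussian whose variance is the corresponding
    quadratic form of the double sum. Almost sure limits of centered Gaussians
    [s_n Z] are centered Gaussian: convergence of the characteristic functions
    [exp (- t^2 s_n^2 / 2)] forces [s_n] to converge, and then both sides can be
    tested against bounded continuous functions. *)

(** * Hilbert spaces and bounded operators *)

(** The obstacle is the singularity of the kernel at [s = tau], which the integral reaches when
    [t = tau]. The surplus [beta - eta] is therefore halved: one [gamma] pays for smallness in the
    mesh, the other leaves [(tau - x)^gamma], which is monotone and stays finite at [x = tau], so
    that the errors telescope whatever the number of points. For double sums the estimate must be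
    uniform in the partition of the variable that is held fixed. This is the purpose of a bound on
    single sums that does not depend on the partition: it makes the inner sum a Hoelder path in the
    outer variable, with one constant for all partitions. Measurability and dominated convergence
    concern sequences, so the probabilistic part runs along uniform partitions. Outside [Nc] the
    values of [X] are arbitrary; completeness of [P] still makes it measurable. Laws are described
    as those of [m + s Z], so that standard deviations tending to 0 need no separate treatment, and
    cosines with a phase yield the real and the imaginary part of the characteristic function
    together. *)

Section inner_product.
Context (R : realType) (H : hilbertType R).
Implicit Types (x y z : H) (a : R).

Lemma innerC x y : inner x y = inner y x.
Proof. by have := hermC (@inner R H) x y; rewrite expr0 mul1r. Qed.

Lemma innerDl x y z : inner (x + y) z = inner x z + inner y z.
Proof. exact: linearDl. Qed.

Lemma innerBl x y z : inner (x - y) z = inner x z - inner y z.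
Proof. exact: linearBl. Qed.

Lemma innerZl a x y : inner (a *: x) y = a * inner x y.
Proof. exact: linearZl_LR. Qed.

Lemma inner0l y : inner (0 : H) y = 0.
Proof. exact: linear0l. Qed.

Lemma innerDr x y z : inner x (y + z) = inner x y + inner x z.
Proof. by rewrite innerC innerDl !(innerC x). Qed.

Lemma innerBr x y z : inner x (y - z) = inner x y - inner x z.
Proof. by rewrite innerC innerBl !(innerC x). Qed.

Lemma innerZr a x y : inner x (a *: y) = a * inner x y.
Proof. by rewrite innerC innerZl innerC. Qed.

Lemma innerNr x y : inner x (- y) = - inner x y.
Proof. by rewrite -scaleN1r innerZr mulN1r. Qed.

Lemma inner0r x : inner x (0 : H) = 0.
Proof. by rewrite innerC inner0l. Qed.

Lemma inner_suml I (r : seq I) (p : pred I) (F : I -> H) y :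
  inner (\sum_(i <- r | p i) F i) y = \sum_(i <- r | p i) inner (F i) y.
Proof. exact: linear_sumlz. Qed.

Lemma sqr_normD x y : `|x + y| ^+ 2 = `|x| ^+ 2 + inner x y *+ 2 + `|y| ^+ 2.
Proof.
by rewrite -!inner_normE innerDl !innerDr (innerC y x) mulr2n !addrA.
Qed.

Lemma cauchy_schwarz x y : `|inner x y| <= `|x| * `|y|.
Proof.
have [->|y0] := eqVneq y 0; first by rewrite inner0r !normr0 mulr0.
have ny : 0 < `|y| ^+ 2 by rewrite exprn_gt0// normr_gt0.
rewrite -(@ler_pXn2r _ 2)// ?nnegrE ?mulr_ge0// exprMn real_normK ?num_real//.
(* The coefficient is the minimiser of [|x + a y|^2] over [a]. *)
have := sqr_ge0 `|x + (- (inner x y / `|y| ^+ 2)) *: y|.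
rewrite sqr_normD innerZr normrZ exprMn real_normK ?num_real// => h.
rewrite -ler_pdivrMr// -subr_ge0; apply: le_trans h _.
rewrite le_eqVlt; apply/orP; left; apply/eqP.
move: ny; set n := `|y| ^+ 2 => n0; field; exact: lt0r_neq0.
Qed.

Lemma inner_ext x y : (forall z, inner x z = inner y z) -> x = y.
Proof.
move=> xy; apply/eqP; rewrite -subr_eq0 -normr_eq0 -sqrf_eq0 -inner_normE.
by rewrite innerBl xy subrr.
Qed.

Lemma cvg_inner (T : Type) (F : set_system T) {FF : Filter F} (f : T -> H) x y :
  f @ F --> x -> (fun t => inner (f t) y) @ F --> inner x y.
Proof.
move=> fx; apply: cvg_zero; apply: norm_cvg0.
have : (fun t => `|f t - x| * `|y|) @ F --> `|(0 : H)| * `|y|.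
  apply: cvgM; last exact: cvg_cst.
  by apply: cvg_norm; rewrite -(subrr x); apply: cvgB => //; exact: cvg_cst.
rewrite normr0 mul0r; apply: squeeze_cvgr; last exact: cvg_cst.
by near=> t => /=; rewrite !fctE normr_ge0/= -innerBl cauchy_schwarz.
Unshelve. all: by end_near. Qed.

End inner_product.

(** * Riesz representation and existence of adjoints *)

Section riesz.
Context (R : realType) (H : hilbertType R).

(* The representing vector minimises [|x|^2 - 2 phi x]; minimising sequences
   are Cauchy by the parallelogram identity. *)
Lemma riesz (phi : H -> R) :
  (forall a x y, phi (a *: x + y) = a * phi x + phi y) ->
  (exists M, forall x, `|phi x| <= M * `|x|) ->
  exists y, forall x, phi x = inner x y.
Proof.
move=> philin [M phiM].
have phi0 : phi 0 = 0 by have := philin (-1) 0 0; rewrite scaler0 addr0; lra.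
have phiZ a x : phi (a *: x) = a * phi x.
  by have := philin a x 0; rewrite phi0 !addr0.
have phiD x y : phi (x + y) = phi x + phi y.
  by have := philin 1 x y; rewrite scale1r mul1r.
pose J x := `|x| ^+ 2 - phi x *+ 2.
have Jlb x : - M ^+ 2 <= J x.
  have := phiM x; rewrite ler_norml => /andP[_ h].
  have := sqr_ge0 (`|x| - M); rewrite /J sqrrB; lra.
have hasinf : has_inf (range J).
  by split; [exists (J 0), 0|exists (- M ^+ 2) => _ [x _ <-]].
pose m := inf (range J).
have mJ x : m <= J x by apply: ge_inf; [exact: hasinf.2|exists x].
have /choice[u uP] (n : nat) : exists x, J x < m + n.+1%:R^-1.
  have e0 : 0 < n.+1%:R^-1 :> R by rewrite invr_gt0.
  by have [_ [x _ <-] h] := inf_adherent e0 hasinf; exists x.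
have par x y : `|x - y| ^+ 2 <= (J x - m + (J y - m)) *+ 2.
  have := mJ (2^-1 *: (x + y)).
  rewrite /J normrZ exprMn phiZ phiD ger0_norm//.
  have := sqr_normD x y; have := sqr_normD x (- y).
  rewrite normrN -scaleN1r innerZr scaleN1r.
  lra.
have cu : cvg (u @ \oo).
  apply/cauchy_cvgP; apply: cauchy_exP => e e0.
  near \oo => N; exists (u N).
  suff : \forall n \near \oo, ball (u N) e (u n) by [].
  near=> n; rewrite -ball_normE/=.
  rewrite -(@ltr_pXn2r _ 2) ?nnegrE// ?ltW//.
  apply: le_lt_trans (par _ _) _.
  have hN : N.+1%:R^-1 < e ^+ 2 / 4.
    by near: N; apply: near_infty_natSinv_lt (PosNum _); rewrite divr_gt0 ?exprn_gt0.
  have hn : n.+1%:R^-1 < e ^+ 2 / 4.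
    by near: n; apply: near_infty_natSinv_lt (PosNum _); rewrite divr_gt0 ?exprn_gt0.
  move: hN hn (uP N) (uP n); set a := N.+1%:R^-1; set b := n.+1%:R^-1; lra.
pose y := lim (u @ \oo).
exists y => x.
(* first-order condition at [y] *)
have phicvg : (fun n => phi (u n)) @ \oo --> phi y.
  apply: cvg_zero; apply: norm_cvg0.
  have : (fun n => M * `|u n - y|) @ \oo --> M * `|(0 : H)|.
    apply: cvgM; first exact: cvg_cst.
    by apply: cvg_norm; rewrite -(subrr y); apply: cvgB => //; exact: cvg_cst.
  rewrite normr0 mulr0; apply: squeeze_cvgr; last exact: cvg_cst.
  near=> n; rewrite /= normr_ge0/=.
  by have := phiM (u n - y); rewrite -scaleN1r phiD phiZ mulN1r.
have Jy : J y <= m.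
  have Jcvg : (fun n => J (u n)) @ \oo --> J y.
    apply: cvgB; last exact: cvgMn.
    by rewrite expr2; under eq_fun do rewrite expr2; apply: cvgM; exact: cvg_norm.
  have mcvg : (fun n => m + n.+1%:R^-1) @ \oo --> m + 0.
    by apply: cvgD; [exact: cvg_cst|exact: cvg_harmonic].
  rewrite addr0 in mcvg.
  apply: (ler_cvg_to Jcvg mcvg); near=> n; exact/ltW.
have quad t : 0 <= (inner y x - phi x) * t *+ 2 + `|x| ^+ 2 * t ^+ 2.
  have := le_trans Jy (mJ (y + t *: x)).
  rewrite /J sqr_normD innerZr phiD phiZ normrZ exprMn real_normK ?num_real//.
  lra.
apply/eqP; rewrite innerC eq_sym -subr_eq0; apply/negPn/negP => c0.
set c := inner y x - phi x in c0 quad.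
(* The best [t] in [quad] is [- c / |x|^2]. If [|x| = 0] the inequality is linear in [t], and
   [t = - c] already contradicts it. *)
have [x0|x0] := eqVneq (`|x| ^+ 2) 0.
  have := quad (- c); rewrite x0.
  have : 0 < c ^+ 2 by rewrite lt0r sqrf_eq0 c0 sqr_ge0.
  rewrite expr2; lra.
have := quad (- c / `|x| ^+ 2).
have : 0 < c ^+ 2 / `|x| ^+ 2.
  by rewrite divr_gt0// ?lt0r ?x0 ?sqrf_eq0 ?c0 ?sqr_ge0.
have -> : (c * (- c / `|x| ^+ 2)) *+ 2 + `|x| ^+ 2 * (- c / `|x| ^+ 2) ^+ 2
   = - (c ^+ 2 / `|x| ^+ 2).
  by field; rewrite -sqrf_eq0.
lra.
Unshelve. all: by end_near. Qed.

(** The choice operator in [adjoint] meets its specification once some adjoint exists. Riesz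
    provides its values one vector at a time, and uniqueness of the representing vector makes them
    linear. *)
Lemma adjointP (A : boundedOp H) x y : inner (A x) y = inner x (adjoint A y).
Proof.
suff : exists B : boundedOp H, forall x y, inner (A x) y = inner x (B y).
  move=> [B AB].
  exact: (@getPex _ [set B : boundedOp H | forall x y : H,
    inner (A x) y = inner x (B y)] (ex_intro _ B AB) x y).
have [M AM] := boundedOp_bounded A.
have ex y' : exists z, forall x', inner (A x') y' = inner x' z.
  apply: riesz => [a u v|]; first by rewrite boundedOp_linear innerDl innerZl.
  exists (M * `|y'|) => u; rewrite (le_trans (cauchy_schwarz _ _))//.
  by rewrite mulrAC ler_wpM2r.
have [B BP] := choice ex.
have Bb : B \in bounded_linear (V := H).
  apply/asboolP; split.
    move=> a u v; apply: inner_ext => w.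
    by rewrite innerDl innerZl !(innerC _ w) -!BP innerDr innerZr.
  (* Testing against [B u] itself gives [|B u|^2 = <A (B u), u> <= |M| |B u| |u|], from which one
     factor [|B u|] cancels. The absolute value is taken because [M] may be negative. *)
  exists `|M| => u; have [->|Bu] := eqVneq `|B u| 0.
    by rewrite mulr_ge0.
  have Bu0 : 0 < `|B u| by rewrite lt0r Bu/=.
  rewrite -(ler_pM2l Bu0) -expr2 -inner_normE -BP.
  apply: le_trans (ler_norm _) _; apply: le_trans (cauchy_schwarz _ _) _.
  rewrite mulrCA mulrA ler_wpM2r// (le_trans (AM _))// ler_wpM2r//.
  exact: ler_norm.
by exists (BoundedOp Bb).
Qed.

End riesz.

Section operators.
Context (R : realType) (V : normedModType R).
Implicit Types A B : boundedOp V.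

Lemma boundedOpD A x y : A (x + y) = A x + A y.
Proof. by have := boundedOp_linear A 1 x y; rewrite !scale1r. Qed.

Lemma boundedOp0r A : A 0 = 0.
Proof. by have := boundedOp_linear A (-1) 0 0; rewrite scaler0 addr0 scaleN1r addNr. Qed.

Lemma boundedOpZ A a x : A (a *: x) = a *: A x.
Proof. by have := boundedOp_linear A a x 0; rewrite boundedOp0r !addr0. Qed.

Lemma boundedOpB A x y : A (x - y) = A x - A y.
Proof. by rewrite boundedOpD -scaleN1r boundedOpZ scaleN1r. Qed.

Lemma sum_boundedOpE I (r : seq I) (p : pred I) (F : I -> boundedOp V) x :
  (\sum_(i <- r | p i) F i) x = \sum_(i <- r | p i) F i x.
Proof. exact: (big_morph (fun A : boundedOp V => A x) (fun A B => erefl) erefl). Qed.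

Lemma le_boundedOp A x : `|A x| <= `|A| * `|x|.
Proof. exact: le_opnorm. Qed.

Lemma boundedOp_norm_le A M : 0 <= M -> (forall x, `|A x| <= M * `|x|) -> `|A| <= M.
Proof.
move=> M0 AM; rewrite boundedOp_normE; apply: ge_sup.
  by exists `|A 0|, 0 => //=; rewrite normr0.
move=> _ [x /= x1 <-]; apply: le_trans (AM _) _; exact: ler_piMr.
Qed.

Lemma opcomp_norm_le A B : `|opcomp A B| <= `|A| * `|B|.
Proof.
apply: boundedOp_norm_le => [|x]; first by rewrite mulr_ge0.
by rewrite /= (le_trans (le_boundedOp _ _))// -mulrA ler_wpM2l// le_boundedOp.
Qed.

Lemma boundedOp_ext A B : A =1 B -> A = B.
Proof. by move=> AB; apply/val_inj/funext. Qed.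

Lemma opcompA A B C : opcomp (opcomp A B) C = opcomp A (opcomp B C).
Proof. exact: boundedOp_ext. Qed.

Lemma opcompDl A B C : opcomp (A + B) C = opcomp A C + opcomp B C.
Proof. exact: boundedOp_ext. Qed.

Lemma opcompBl A B C : opcomp (A - B) C = opcomp A C - opcomp B C.
Proof. exact: boundedOp_ext. Qed.

Lemma opcompDr A B C : opcomp A (B + C) = opcomp A B + opcomp A C.
Proof. by apply: boundedOp_ext => x /=; rewrite boundedOpD. Qed.

Lemma opcompBr A B C : opcomp A (B - C) = opcomp A B - opcomp A C.
Proof. by apply: boundedOp_ext => x /=; rewrite boundedOpB. Qed.

End operators.

Lemma cvg_norm_le (R : realType) (V : normedModType R) (T : Type)
    (F : set_system T) {FF : ProperFilter F} (f : T -> V) (l : V) (M : R) :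
  f @ F --> l -> (\forall t \near F, `|f t| <= M) -> `|l| <= M.
Proof.
move=> fl fM; rewrite leNgt; apply/negP => Ml.
have [t [/= tM]] : exists t, `|f t| <= M /\ `|l - f t| < `|l| - M.
  apply: (@filter_ex _ F); apply: filterI => //.
  by move/cvgrPdist_lt: fl; apply; rewrite subr_gt0.
by have := ler_distD (f t) l 0; rewrite !subr0; lra.
Qed.

Lemma cvg_boundedOp (R : realType) (V : normedModType R) (T : Type)
    (F : set_system T) {FF : Filter F} (f : T -> boundedOp V) (A : boundedOp V) x :
  f @ F --> A -> (fun t => f t x) @ F --> A x.
Proof.
move=> fA; apply: cvg_zero; apply: norm_cvg0.
have : (fun t => `|f t - A| * `|x|) @ F --> `|(0 : boundedOp V)| * `|x|.
  apply: cvgM; last exact: cvg_cst.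
  by apply: cvg_norm; rewrite -(subrr A); apply: cvgB => //; exact: cvg_cst.
rewrite normr0 mul0r; apply: squeeze_cvgr; last exact: cvg_cst.
by near=> t => /=; rewrite !fctE normr_ge0/= (le_boundedOp (f t - A)).
Unshelve. all: by end_near. Qed.

(** * Norm of the adjoint and completeness of the space of operators *)

Section adjoint_theory.
Context (R : realType) (H : hilbertType R).
Implicit Types A B : boundedOp H.

Lemma adjointB A B : adjoint (A - B) = adjoint A - adjoint B.
Proof.
apply: boundedOp_ext => x; apply: inner_ext => z.
rewrite innerC -adjointP [in RHS]innerC innerBr -!adjointP -innerBl.
by [].
Qed.

Lemma adjoint_norm_le A : `|adjoint A| <= `|A|.
Proof.
apply: boundedOp_norm_le => // x.
have [->|Ax] := eqVneq `|adjoint A x| 0; first by rewrite mulr_ge0.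
have Ax0 : 0 < `|adjoint A x| by rewrite lt0r Ax/=.
rewrite -(ler_pM2l Ax0) -expr2 -inner_normE -adjointP.
apply: le_trans (ler_norm _) _; apply: le_trans (cauchy_schwarz _ _) _.
by rewrite mulrCA mulrA ler_wpM2r// le_boundedOp.
Qed.

(* [boundedOp H] is not registered as a complete space, hence the explicit
   construction of the limit. *)
Lemma boundedOp_cauchy_cvg (T : Type) (F : set_system T) {FF : ProperFilter F}
    (f : T -> boundedOp H) :
  (forall e, 0 < e -> \forall s & t \near F, `|f s - f t| < e) ->
  cvg (f @ F).
Proof.
move=> fc.
have fc2 e : 0 < e -> \forall s \near F, \forall t \near F, `|f s - f t| < e.
  by move=> e0; apply: (@nearP_dep _ _ F F); exact: fc.
have cx x : cvg ((fun t => f t x) @ F).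
  apply/cauchy_cvgP; apply: cauchy_exP => e e0.
  have x1 : 0 < `|x| + 1 by rewrite ltr_wpDl.
  near F => s; exists (f s x).
  suff : \forall t \near F, ball (f s x) e (f t x) by [].
  have : \forall t \near F, `|f s - f t| < e / (`|x| + 1).
    by near: s; apply: fc2; rewrite divr_gt0.
  apply: filterS => t st; rewrite -ball_normE/=.
  apply: le_lt_trans (le_boundedOp (f s - f t) x) _.
  apply: (@le_lt_trans _ _ (e / (`|x| + 1) * `|x|)).
    by rewrite ler_wpM2r// ltW.
  by rewrite -mulrA mulrC gtr_pMl// mulrC ltr_pdivrMr// mul1r ltrDl.
pose g x := lim ((fun t => f t x) @ F).
have gP x : (fun t => f t x) @ F --> g x by exact: cx.
(* Letting [t] run along [F] with [s] fixed turns the Cauchy property into a bound on [f s - g]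
   proportional to [|x|]. It serves twice: for boundedness of [g] and for convergence in operator
   norm. *)
have gle s e x : (\forall t \near F, `|f s - f t| <= e) ->
    `|f s x - g x| <= e * `|x|.
  move=> st.
  suff h3 : \forall t \near F, `|f s x - f t x| <= e * `|x|.
    exact: (cvg_norm_le (cvgB (cvg_cst _) (gP x)) h3).
  move: st; apply: filterS => t st.
  by apply: le_trans (le_boundedOp (f s - f t) x) _; rewrite ler_wpM2r.
have gb : g \in bounded_linear (V := H).
  apply/asboolP; split.
    move=> a x y; have := gP (a *: x + y).
    under eq_fun do rewrite boundedOp_linear.
    have : (fun t => a *: f t x + f t y) @ F --> a *: g x + g y.
      by apply: cvgD => //; apply: cvgZl_tmp.
    by move=> h1 h2; apply: (cvg_unique _ h2 h1).
  near F => s; exists (`|f s| + 1) => x.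
  have h : `|f s x - g x| <= 1 * `|x|.
    apply: gle; have : \forall t \near F, `|f s - f t| < 1 by near: s; exact: fc2.
    by apply: filterS => t /ltW.
  have := ler_normB (f s x) (f s x - g x); rewrite subKr => /le_trans; apply.
  by rewrite mulrDl lerD// le_boundedOp.
apply/cvg_ex; exists (BoundedOp gb); apply/cvgrPdist_le => e e0.
apply: filterS (fc2 e e0) => s hs; rewrite distrC.
apply: boundedOp_norm_le => [|x]; first exact: ltW.
by apply: gle; apply: filterS hs => t /ltW.
Unshelve. all: by end_near. Qed.

End adjoint_theory.

(** * Convergence of Volterra sums *)

Section germ_sums.
Context (R : realType).

(** The left end point is an argument so that inductions can restart a partition anywhere; the sums
    indexed by [node] always start at 0. *)
Fixpoint germ_sum (V : zmodType) (G : R -> R -> V) (u : R) (s : seq R) : V :=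
  if s is v :: s' then G u v + germ_sum G v s' else 0.

Lemma germ_sumE (V : zmodType) (G : R -> R -> V) (s : seq R) :
  \sum_(i < size s) G (node s i) (node s i.+1) = germ_sum G 0 s.
Proof.
suff h (u : R) : \sum_(i < size s) G (nth 0 (u :: s) i) (nth 0 (u :: s) i.+1) =
    germ_sum G u s by exact: h.
elim: s u => [|v s IH] u; first by rewrite big_ord0.
by rewrite big_ord_recl /= -(IH v).
Qed.

Lemma eq_germ_sum (V : zmodType) (G G' : R -> R -> V) u s :
  (forall a b, G a b = G' a b) -> germ_sum G u s = germ_sum G' u s.
Proof. by move=> GG'; elim: s u => //= v s IH u; rewrite GG' IH. Qed.

Lemma germ_sumB (V : zmodType) (G G' : R -> R -> V) u s :
  germ_sum G u s - germ_sum G' u s = germ_sum (fun a b => G a b - G' a b) u s.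
Proof.
elim: s u => [|v s IH] u /=; first by rewrite subr0.
by rewrite opprD addrACA IH.
Qed.

Lemma germ_sum_morph (V V' : zmodType) (f : V -> V') (G : R -> R -> V) u s :
  f 0 = 0 -> {morph f : x y / x + y} ->
  f (germ_sum G u s) = germ_sum (fun a b => f (G a b)) u s.
Proof. by move=> f0 fD; elim: s u => //= v s IH u; rewrite fD IH. Qed.

Lemma germ_sum_exchange (V : zmodType) (G : R -> R -> R -> R -> V) u s u' s' :
  germ_sum (fun a b => germ_sum (G a b) u' s') u s =
  germ_sum (fun a' b' => germ_sum (fun a b => G a b a' b') u s) u' s'.
Proof.
elim: s u => [|v s IH] u /=.
  by elim: s' u' => //= v' s' IH' u'; rewrite add0r -IH'.
rewrite IH; elim: s' u' {IH} => [|v' s' IH'] u' /=; first by rewrite addr0.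
by rewrite addrACA IH'.
Qed.

(* One interior point [m] of the finer partition is inserted at a time, from
   left to right; the errors telescope through [phi]. *)
Lemma germ_sum_refine (V : normedModType R) (G : R -> R -> V) (phi : R -> R)
    (t delta : R) :
  (forall a b, 0 <= a -> a <= b -> b <= t -> phi b <= phi a) ->
  (forall a m b, 0 <= a -> a < m -> m < b -> b <= t -> b - a <= delta ->
    `|G a b - G a m - G m b| <= phi a - phi m) ->
  forall r s u, 0 <= u -> path <%R u r -> last u r = t ->
    path <%R u s -> path (fun x y => y - x <= delta) u s -> last u s = t ->
    subseq s r ->
  `|germ_sum G u s - germ_sum G u r| <= phi u - phi t.
Proof.
move=> phi_ni HG; elim=> [|m r IH] s u u0.
  case: s => //= _ ut _ _ _ _; by rewrite ut !subrr normr0.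
move=> /= /andP[um mr] rt; have mt : m <= t.
  by apply: (@itv_partition_le _ _ _ _ r); split => //; exact/eqP.
case: s => [_ _ /= ut|v s /= /andP[uv vs] /andP[uvd vsd] st].
  by move: um; rewrite ut ltNge mt.
have vt : v <= t.
  by apply: (@itv_partition_le _ _ _ _ s); split => //; exact/eqP.
have m0 : 0 <= m by rewrite (le_trans u0)// ltW.
(* If both partitions have the same next point, both advance. Otherwise [m] lies strictly before
   [v], and the coarse partition is restarted at [m]: its first interval [[m, v]] is shorter than
   [[u, v]], so the mesh condition persists. *)
case: eqP => [vm|vm] sr.
  subst v; rewrite opprD addrACA subrr add0r.
  apply: le_trans (IH s m _ _ _ _ _ _ _) _ => //.
  by rewrite lerB// phi_ni// ltW.
have mv : m < v.
  have /mem_subseq/(_ v) := sr; rewrite inE eqxx => /(_ isT) vr.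
  by have /allP/(_ _ vr) := order_path_min lt_trans mr.
have := IH (v :: s) m m0 mr rt; rewrite /= mv vs vsd st sr => /(_ isT).
rewrite andbT => IH'.
have {}IH' := IH' (le_trans (lerB (lexx _) (ltW um)) uvd) erefl isT.
have -> : G u v + germ_sum G v s - (G u m + germ_sum G m r) =
  (G u v - G u m - G m v) + (G m v + germ_sum G v s - germ_sum G m r).
  by rewrite opprD !addrA subrK (addrAC (G u v)).
rewrite (le_trans (ler_normD _ _))//.
have -> : phi u - phi t = (phi u - phi m) + (phi m - phi t) by ring.
by rewrite lerD// HG.
Qed.

(** Write [a^g - b^g = b^g ((a/b)^g - 1)]. Then [exp y >= 1 + y] gives [(a/b)^g - 1 >= g ln (a/b)],
    and [ln (1 + y) <= y] at [y = b/a - 1] gives [ln (a/b) >= (a - b)/a]. *)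
Lemma powR_increment_ge (g a b : R) : 0 < g -> 0 < b -> b <= a ->
  g * (b `^ g * ((a - b) / a)) <= a `^ g - b `^ g.
Proof.
move=> g0 b0 ba; have a0 : 0 < a by exact: lt_le_trans ba.
have -> : a `^ g = b `^ g * (a / b) `^ g.
  by rewrite -powRM ?divr_ge0 ?(ltW a0) ?(ltW b0)// mulrC divfK// gt_eqF.
rewrite mulrCA -[X in _ <= _ - X]mulr1 -mulrBr ler_wpM2l ?powR_ge0//.
rewrite lerBrDr addrC /powR gt_eqF ?divr_gt0// -[leLHS]/(1 + _).
apply: le_trans (expR_ge1Dx _); rewrite lerD2l ler_pM2l//.
have := @le_ln1Dx R (b / a - 1) _; rewrite subrKC => /(_ _)/le_trans h.
rewrite -[a / b]invf_div lnV ?posrE ?divr_gt0// lerNr.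
apply: h; first by rewrite ltrBDr addNr divr_gt0.
by rewrite mulrBl divff ?gt_eqF// opprB.
Qed.

End germ_sums.

(** * Meshes and common refinements *)

Section partitions.
Context (R : realType).
Implicit Types (s r : seq R) (t delta : R).

Lemma mesh_path s delta : mesh s <= delta -> path (fun x y => y - x <= delta) 0 s.
Proof.
move=> sd; apply/(pathP 0) => i si; apply: le_trans sd.
exact: (le_bigmax _ (fun i : 'I_(size s) => node s i.+1 - node s i) (Ordinal si)).
Qed.

Lemma path_le_last (u x : R) s : path <%R u s -> x \in u :: s -> x <= last u s.
Proof.
elim: s u x => [|v s IH] u x /=; first by rewrite inE => _ /eqP ->.
move=> /andP[uv vs]; rewrite inE => /predU1P[->|]; last exact: IH.
by rewrite (le_trans (ltW uv))// IH// mem_head.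
Qed.

Lemma partition_itv t s (x : R) : itv_partition 0 t s -> x \in s -> 0 < x <= t.
Proof.
case=> s0 /eqP <- xs; have /allP/(_ _ xs) /= -> := order_path_min lt_trans s0.
by rewrite path_le_last// inE xs orbT.
Qed.

Lemma common_refinement t s s' :
  itv_partition 0 t s -> itv_partition 0 t s' ->
  exists r, [/\ itv_partition 0 t r, subseq s r & subseq s' r].
Proof.
move=> ps ps'; pose r := sort <=%R (undup (s ++ s')).
have rE : r =i s ++ s' by move=> x; rewrite mem_sort mem_undup.
have rs : sorted <%R r by rewrite sort_lt_sorted undup_uniq.
have sub u : itv_partition 0 t u -> {subset u <= r} -> subseq u r.
  case=> u0 _ ur; have -> : u = [seq x <- r | x \in u]; last exact: filter_subseq.
  apply: lt_sorted_eq; [exact: path_sorted u0|exact: lt_sorted_filter|].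
  by move=> x; rewrite mem_filter; apply/idP/andP => [xu|[]//]; split => //; exact: ur.
have rle x : x \in r -> 0 < x <= t.
  by rewrite rE mem_cat => /orP[]; exact: partition_itv.
exists r; split; last 2 first.
- by apply: sub => // x xs; rewrite rE mem_cat xs.
- by apply: sub => // x xs; rewrite rE mem_cat xs orbT.
split.
  rewrite path_min_sorted//; apply/allP => x /rle/andP[] //.
(* A nonempty partition contains its last point [t]. So [t] is missing from [r] only if [s] is
   empty, which forces [t = 0] and empties [s'] too. *)
have [tr|tr] := boolP (t \in r); last first.
  have s0 : s = [::].
    apply/eqP; rewrite -size_eq0 -leqn0 leqNgt; apply/negP => s0; case/negP: tr.
    rewrite rE mem_cat; case: ps => _ /eqP <-.
    by case: (s) s0 => // y u _; rewrite /= mem_last.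
  have t0 : 0 = t by apply: itv_partition_nil; rewrite -s0.
  move: ps'; rewrite -t0 => /itv_partitionxx s'0.
  by rewrite /r s0 s'0.
rewrite eq_le; have r0 : path <%R 0 r.
  by rewrite path_min_sorted//; apply/allP => x /rle/andP[].
rewrite [X in _ && X]path_le_last ?inE ?tr ?orbT// andbT.
case: (r) tr rle => //= y q _ rle.
by have /andP[] := rle _ (mem_last y q).
Qed.

End partitions.

Lemma powRD_gt0 (R : realType) (x r s : R) : 0 < x ->
  x `^ (r + s) = x `^ r * x `^ s.
Proof. by move=> x0; rewrite powRD// (gt_eqF x0) implybT. Qed.

(** * Refinement estimates for singular kernels and Hoelder paths *)

Section singular_kernels.
Context (R : realType) (V V' : normedModType R).
Implicit Types (k : R -> V -> V') (w : R -> V) (s r : seq R).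

(* The second bound interpolates between the Hoelder exponents [0] and [1] of
   the kernel in its second variable. *)
Definition singular_kernel (tau eta C : R) k :=
  [/\ forall u x y, k u (x - y) = k u x - k u y,
      forall u x, 0 <= u -> u < tau -> `|k u x| <= C * (tau - u) `^ (- eta) * `|x| &
      forall a m x, 0 <= a -> a < m -> m < tau ->
        `|k a x - k m x| <= C * (tau - m) `^ (- eta) * ((m - a) / (tau - a)) * `|x|].

Definition hoelder_path (t M beta : R) w :=
  forall x y, 0 <= x -> x <= y -> y <= t -> `|w y - w x| <= M * (y - x) `^ beta.

Definition path_germ k w (a b : R) : V' := k a (w b - w a).

Context (tau t eta gamma beta C M : R) (k : R -> V -> V') (w : R -> V).
Context (t_tau : t <= tau) (eta0 : 0 < eta) (gamma0 : 0 < gamma)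
  (betaE : beta = eta + gamma + gamma) (C0 : 0 <= C) (M0 : 0 <= M)
  (hk : singular_kernel tau eta C k) (hw : hoelder_path t M beta w).

Lemma path_germ_defect (delta a m b : R) :
  0 <= a -> a < m -> m < b -> b <= t -> b - a <= delta ->
  `|path_germ k w a b - path_germ k w a m - path_germ k w m b| <=
  C * M * delta `^ gamma / gamma * ((tau - a) `^ gamma - (tau - m) `^ gamma).
Proof.
move=> a0 am mb bt abd; case: hk => kB k1 k2.
have mt : m < tau by rewrite (lt_le_trans mb)// (le_trans bt).
have at_ : a < tau by exact: lt_trans mt.
have -> : path_germ k w a b - path_germ k w a m - path_germ k w m b =
    k a (w b - w m) - k m (w b - w m).
  by rewrite /path_germ -kB opprB addrA subrK.
apply: le_trans (k2 _ _ _ a0 am mt) _.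
have B0 : 0 < tau - m by rewrite subr_gt0.
have A0 : 0 < tau - a by rewrite subr_gt0.
(* [b - m] is at most [delta] and at most [tau - m]. The exponent [gamma] goes to the first bound
   and [eta + gamma] to the second, whose part [eta] cancels the singularity of the kernel ([pB]
   below). *)
have hD : `|w b - w m| <= M * (delta `^ gamma * (tau - m) `^ (eta + gamma)).
  apply: le_trans (hw _ (ltW mb) bt) _; first by rewrite (le_trans a0)// ltW.
  rewrite ler_wpM2l// (_ : beta = gamma + (eta + gamma)).
    2: by rewrite betaE; ring.
  rewrite (powRD_gt0 gamma (eta + gamma)) ?subr_gt0//.
  rewrite ler_pM ?powR_ge0//.
    by rewrite ge0_ler_powR ?nnegrE ?(ltW gamma0)//; move: gamma0 t_tau; lra.
  by rewrite ge0_ler_powR ?nnegrE//; move: eta0 gamma0 t_tau; lra.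
apply: (@le_trans _ _ (C * (tau - m) `^ (- eta) * ((m - a) / (tau - a)) *
    (M * (delta `^ gamma * (tau - m) `^ (eta + gamma))))).
  rewrite ler_wpM2l// !mulr_ge0// ?powR_ge0// ?invr_ge0 ?subr_ge0 ltW//.
have -> : (tau - m) `^ (eta + gamma) = (tau - m) `^ eta * (tau - m) `^ gamma.
  exact: powRD_gt0.
have pB : (tau - m) `^ (- eta) * (tau - m) `^ eta = 1.
  by rewrite powRN mulVf// gt_eqF// powR_gt0.
have -> : C * (tau - m) `^ (- eta) * ((m - a) / (tau - a)) *
     (M * (delta `^ gamma * ((tau - m) `^ eta * (tau - m) `^ gamma))) =
   C * M * delta `^ gamma * ((tau - m) `^ gamma * ((m - a) / (tau - a))).
  by rewrite -[RHS]mul1r -pB; ring.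
rewrite -!mulrA !ler_wpM2l ?powR_ge0// ler_pdivlMl//.
have -> : m - a = (tau - a) - (tau - m) by ring.
by apply: powR_increment_ge; move: gamma0; lra.
Qed.

Lemma path_germ_sum_refine delta s r :
  itv_partition 0 t s -> itv_partition 0 t r -> subseq s r -> mesh s <= delta ->
  `|germ_sum (path_germ k w) 0 s - germ_sum (path_germ k w) 0 r| <=
  C * M * delta `^ gamma / gamma * tau `^ gamma.
Proof.
move=> ps [r0 /eqP rt] sr sd; have t0 := itv_partition_le ps.
pose phi x := C * M * delta `^ gamma / gamma * (tau - x) `^ gamma.
have K0 : 0 <= C * M * delta `^ gamma / gamma.
  by rewrite !mulr_ge0 ?powR_ge0// invr_ge0 ltW.
case: ps => s0 /eqP st.
apply: (@le_trans _ _ (phi 0 - phi t)).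
  apply: (@germ_sum_refine _ _ _ phi t delta) => //; last exact: mesh_path.
    move=> a b a0 ab bt; rewrite /phi ler_wpM2l//.
    rewrite ge0_ler_powR ?nnegrE ?(ltW gamma0)//; move: gamma0 t_tau; lra.
  by move=> a m b *; rewrite /phi -mulrBr; exact: path_germ_defect.
by rewrite /phi subr0 gerBl mulr_ge0// powR_ge0.
Qed.

(** Both sums are compared with that of a common refinement, hence the factor 2. This is the Cauchy
    estimate behind all the limits over partitions. *)
Lemma path_germ_sum_close delta s s' :
  itv_partition 0 t s -> itv_partition 0 t s' ->
  mesh s <= delta -> mesh s' <= delta ->
  `|germ_sum (path_germ k w) 0 s - germ_sum (path_germ k w) 0 s'| <=
  C * M * delta `^ gamma / gamma * tau `^ gamma *+ 2.
Proof.
move=> ps ps' sd s'd; have [r [pr sr s'r]] := common_refinement ps ps'.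
have h := path_germ_sum_refine ps pr sr sd.
have h' := path_germ_sum_refine ps' pr s'r s'd.
apply: le_trans (ler_distD (germ_sum (path_germ k w) 0 r) _ _) _.
by rewrite mulr2n lerD// distrC.
Qed.

(** Comparison with the partition into a single interval, whose mesh is [t]. Its only term accounts
    for the 1 in the constant and the refinement error for [gamma^-1], after [t] is bounded by
    [tau]. *)
Lemma path_germ_sum_bound s : itv_partition 0 t s ->
  `|germ_sum (path_germ k w) 0 s| <=
  C * M * (tau `^ (gamma + gamma) * (1 + gamma^-1)).
Proof.
move=> ps; have := itv_partition_le ps; rewrite le_eqVlt => /predU1P[t0|t0].
  move: ps; rewrite -t0 => /itv_partitionxx -> /=; rewrite normr0.
  by rewrite !mulr_ge0 ?powR_ge0// addr_ge0// invr_ge0 ltW.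
have tau0 : 0 < tau by exact: lt_le_trans t_tau.
have p1 := itv_partition1 t0.
have sub : subseq [:: t] s.
  rewrite sub1seq; case: (s) ps => [[_ /eqP /= t00]|y q [_ /eqP <-]].
    by move: t0; rewrite t00 ltxx.
  by rewrite /= mem_last.
have m1 : mesh [:: t] <= t.
  by rewrite /mesh big_ord_recl big_ord0 /node /= subr0 ge_max lexx ltW.
have h := path_germ_sum_refine p1 ps sub m1.
rewrite -[X in `|X|](subKr (germ_sum (path_germ k w) 0 [:: t])).
apply: le_trans (ler_normB _ _) _; rewrite mulrDr mulr1 mulrDr; apply: lerD.
  rewrite /= addr0 /path_germ; case: hk => _ k1 _.
  apply: le_trans (k1 _ _ (lexx _) tau0) _; rewrite subr0.
  apply: (@le_trans _ _ (C * tau `^ (- eta) * (M * tau `^ beta))).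
    rewrite ler_wpM2l ?mulr_ge0 ?powR_ge0//.
    apply: le_trans (hw (lexx _) (ltW t0) (lexx _)) _.
    rewrite subr0 ler_wpM2l// ge0_ler_powR ?nnegrE// ?(ltW t0) ?(ltW tau0)//.
    by rewrite betaE; move: eta0 gamma0; lra.
  rewrite le_eqVlt; apply/orP; left; apply/eqP.
  have -> : gamma + gamma = - eta + beta by rewrite betaE; ring.
  by rewrite powRD_gt0//; ring.
apply: le_trans h _; rewrite powRD_gt0//.
have -> : C * M * t `^ gamma / gamma * tau `^ gamma =
  (C * M * (tau `^ gamma / gamma)) * t `^ gamma by ring.
have -> : C * M * (tau `^ gamma * tau `^ gamma / gamma) =
  (C * M * (tau `^ gamma / gamma)) * tau `^ gamma by ring.
rewrite ler_wpM2l// ?mulr_ge0 ?powR_ge0 ?invr_ge0 ?(ltW gamma0)//.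
by rewrite ge0_ler_powR ?nnegrE ?(ltW gamma0) ?(ltW t0) ?(ltW tau0).
Qed.

End singular_kernels.

(** * The filter of vanishing mesh and a sequence converging along it *)

Section mesh_filter.
Context (R : realType).
Implicit Types (t delta : R).

(** At [t = 0] the equidistant points would coincide, whereas a partition is strictly increasing;
    the only partition there is the empty one. *)
Definition uniform_partition t (n : nat) : seq R :=
  if t == 0 then [::] else [seq t * i%:R / n.+1%:R | i <- iota 1 n.+1].

Lemma uniform_partitionP t n : 0 <= t ->
  itv_partition 0 t (uniform_partition t n) /\ mesh (uniform_partition t n) <= t / n.+1%:R.
Proof.
rewrite le_eqVlt /uniform_partition eq_sym => /predU1P[->|t0].
  rewrite eqxx mul0r; split; first by split.
  by rewrite /mesh big_ord0.
rewrite gt_eqF//; set f := fun i : nat => t * i%:R / n.+1%:R.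
have fS i : f i.+1 - f i = t / n.+1%:R.
  by rewrite /f -mulrBl -mulrBr -natrB// subSnn mulr1.
have f0 : f 0%N = 0 by rewrite /f mulr0 mul0r.
have nthf i : (i <= n.+1)%N -> nth 0 (0 :: map f (iota 1 n.+1)) i = f i.
  by case: i => [|i] // ni; rewrite [LHS](nth_map 0%N) ?size_iota// nth_iota.
split.
  split.
    apply/(pathP 0) => i; rewrite size_map size_iota => ni.
    rewrite nthf; last exact: ltnW.
    have -> : nth 0 (map f (iota 1 n.+1)) i = f i.+1 by exact: (nthf i.+1).
    by rewrite -subr_gt0 fS divr_gt0.
  rewrite (last_nth 0) size_map size_iota nthf// /f mulfK// pnatr_eq0.
apply/bigmax_leP; split => [|i _]; first by rewrite divr_ge0// ltW.
have ni : (i < n.+1)%N by apply: leq_trans (ltn_ord i) _; rewrite size_map size_iota.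
by rewrite /node !nthf ?fS// ltnW.
Qed.

Lemma near_uniform_partition t delta : 0 <= t -> 0 < delta ->
  \forall n \near \oo, itv_partition 0 t (uniform_partition t n) /\
    mesh (uniform_partition t n) < delta.
Proof.
move=> t0 d0; have t1 : 0 < t + 1 by rewrite ltr_wpDl.
near=> n; have [pn mn] := uniform_partitionP n t0; split => //.
apply: le_lt_trans mn _.
have : n.+1%:R^-1 < delta / (t + 1).
  by near: n; apply: near_infty_natSinv_lt (PosNum _); rewrite divr_gt0.
rewrite ltr_pdivlMr// => h; apply: le_lt_trans h.
by rewrite mulrC ler_wpM2l ?invr_ge0// lerDl.
Unshelve. all: by end_near. Qed.

Lemma mesh_to0_proper t : 0 <= t -> ProperFilter (mesh_to0 t).
Proof.
move=> t0; apply: filter_from_proper; last first.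
  move=> delta /= d0.
  have [n] := @filter_ex _ _ _ _ (near_uniform_partition t0 d0).
  by exists (uniform_partition t n).
apply: filter_from_filter; first by exists 1 => /=.
move=> a b /= a0 b0; exists (Num.min a b); first by rewrite /= lt_min a0.
by move=> s [ps]; rewrite lt_min => /andP[].
Qed.

Lemma cvg_uniform_partition t : 0 <= t -> uniform_partition t @ \oo --> mesh_to0 t.
Proof.
move=> t0 A [delta /= d0 dA]; rewrite /nbhs/=.
by apply: filterS (near_uniform_partition t0 d0) => n; exact: dA.
Qed.

End mesh_filter.

(** * Pointwise bounds from the class norms *)

Section class_bounds.
Context (R : realType) (V : normedModType R).

(** The class norms are sums of extended real suprema. To extract finiteness of one term the others
    must be nonnegative, and a supremum is so only once its set is known to contain a nonnegative
    value, which is why admissible times such as [T / 2] and [T / 4] are exhibited below. *)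
Lemma ereal_sup_nonneg (S : set (\bar R)) (x : R) :
  0 <= x -> S x%:E -> (0 <= ereal_sup S)%E.
Proof. by move=> x0 Sx; apply: le_trans (ereal_sup_ubound Sx). Qed.

Lemma ereal_sup_bound (S : set (\bar R)) :
  (0 <= ereal_sup S)%E -> (ereal_sup S < +oo)%E ->
  exists2 C : R, 0 <= C & forall x : R, S x%:E -> x <= C.
Proof.
move=> S0 Soo; exists (fine (ereal_sup S)); first exact: fine_ge0.
move=> x Sx; rewrite -lee_fin fineK ?ge0_fin_numE//.
exact: ereal_sup_ubound.
Qed.

(** The last bound merges [theta = 0] and [theta = 1]: with [x = u - s] and [y = t - u], the minimum
    of 1 and [x / y] is at most [2 x / (x + y)]. The fraction [(u - s) / (t - s)] is the one that
    [powR_increment_ge] can telescope. *)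
Lemma kernel_class_bounds (T eta : R) (K : R -> R -> V) : 0 < T ->
  kernel_class T eta K ->
  exists C, [/\ 0 <= C,
    forall t s, 0 <= s -> s < t -> t <= T -> `|K t s| <= C * (t - s) `^ (- eta) &
    forall t u s, 0 <= s -> s < u -> u < t -> t <= T ->
      `|K t u - K t s| <= C * (t - u) `^ (- eta) * ((u - s) / (t - s))].
Proof.
move=> T0; rewrite /kernel_class/= /kernel_norm.
have n1 : (0 <= kernel_norm1 T eta K)%E.
  apply: (@ereal_sup_nonneg _ (`|K T 0| / `|T - 0| `^ (- eta))).
    by rewrite divr_ge0// powR_ge0.
  by exists T, 0; split.
have n2 : (0 <= kernel_norm2 T eta K)%E.
  apply: (@ereal_sup_nonneg _ (`|K T 0 - K (T / 2) 0| /
      (`|T - T / 2| `^ 0 * `|T / 2 - 0| `^ (- 0 - eta)))).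
    by rewrite divr_ge0// mulr_ge0 ?powR_ge0.
  by exists T, (T / 2), 0, 0; split => //; [split; lra|lra].
have n3 : (0 <= kernel_norm3 T eta K)%E.
  apply: (@ereal_sup_nonneg _ (`|K T (T / 2) - K T 0| /
      (`|T / 2 - 0| `^ 0 * `|T - T / 2| `^ (- 0 - eta)))).
    by rewrite divr_ge0// mulr_ge0 ?powR_ge0.
  by exists T, (T / 2), 0, 0; split => //; [split; lra|lra].
have n4 : (0 <= kernel_norm4 T eta K)%E.
  apply: (@ereal_sup_nonneg _ (`|K T (T / 4) - K T 0 - K (T / 2) (T / 4) + K (T / 2) 0| /
      (`|T / 2 - T / 4| `^ (- 0 - 0 - eta) * `|T - T / 2| `^ 0 * `|T / 4 - 0| `^ 0))).
    by rewrite divr_ge0// ?mulr_ge0 ?powR_ge0.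
  by exists T, (T / 2), (T / 4), 0, 0, 0; split => //; [split; lra|lra|lra].
move=> fin.
have f1 : (kernel_norm1 T eta K < +oo)%E.
  by apply: le_lt_trans fin; rewrite -!addeA leeDl// !adde_ge0.
have f3 : (kernel_norm3 T eta K < +oo)%E.
  by apply: le_lt_trans fin; rewrite -addeA addeCA leeDl// !adde_ge0.
have [C1 C10 K1] := ereal_sup_bound n1 f1.
have [C3 C30 K3] := ereal_sup_bound n3 f3.
exists (C1 + C3 *+ 2); split => [|t s s0 st tT|t u s s0 su ut tT].
- by rewrite addr_ge0// mulrn_wge0.
- have ts : 0 < t - s by rewrite subr_gt0.
  have := K1 (`|K t s| / `|t - s| `^ (- eta)).
  rewrite gtr0_norm// ler_pdivrMr ?powR_gt0// => h.
  apply: (@le_trans _ _ (C1 * (t - s) `^ (- eta))).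
    by apply: h; exists t, s; rewrite gtr0_norm.
  by rewrite ler_wpM2r ?powR_ge0// lerDl mulrn_wge0.
have us0 : 0 < u - s by rewrite subr_gt0.
have tu0 : 0 < t - u by rewrite subr_gt0.
have ts0 : 0 < t - s by lra.
have K3' theta : 0 <= theta <= 1 ->
    `|K t u - K t s| <= C3 * ((u - s) `^ theta * (t - u) `^ (- theta - eta)).
  move=> th; rewrite -ler_pdivrMr ?mulr_gt0 ?powR_gt0//; apply: K3.
  by exists t, u, s, theta; split => //; rewrite !gtr0_norm.
have B0 := powR_ge0 (t - u) (- eta).
have X0 : 0 <= (u - s) / (t - s) by rewrite divr_ge0// ltW.
apply: (@le_trans _ _ (C3 *+ 2 * (t - u) `^ (- eta) * ((u - s) / (t - s)))); last first.
  by rewrite ler_wpM2r// ler_wpM2r// lerDr.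
(* If [t - s <= 2 (t - u)], replacing [t - u] by [t - s] in the bound for [theta = 1] costs at most
   a factor 2. Otherwise [(u - s) / (t - s)] exceeds 1/2 and [theta = 0] suffices. *)
have [h|h] := leP (t - s) ((t - u) *+ 2).
  have := K3' 1; rewrite ler01 lexx => /(_ isT) /le_trans; apply.
  rewrite powRr1 ?(ltW us0)// powRD_gt0// powR_inv1 ?(ltW tu0)//.
  have hq : (u - s) / (t - u) <= (u - s) / (t - s) *+ 2.
    rewrite ler_pdivrMr// mulrnAl -mulrnAr -mulrA ler_peMr ?(ltW us0)//.
    by rewrite ler_pdivlMl// mulr1.
  have -> : C3 * ((u - s) * ((t - u)^-1 * (t - u) `^ (- eta))) =
    C3 * (t - u) `^ (- eta) * ((u - s) / (t - u)) by ring.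
  rewrite mulrnAl mulrnAl -mulrnAr ler_wpM2l//.
  by rewrite mulr_ge0.
have := K3' 0; rewrite lexx ler01 => /(_ isT) /le_trans; apply.
rewrite powRr0 mul1r oppr0 add0r mulrnAl -mulrnAr -mulrA ler_wpM2l//.
by rewrite mulrnAl -mulrnAr ler_peMr// -mulr_natr mulrAC ler_pdivlMr//; lra.
Qed.

Lemma covariance_class_bound (T alpha : R) (Q : R -> R -> V) : 0 < T ->
  covariance_class T alpha Q ->
  exists2 C, 0 <= C & forall s t s' t',
    0 <= s -> s <= t -> t <= T -> 0 <= s' -> s' <= t' -> t' <= T ->
    `|rect_incr Q s s' t t'| <= C * (t - s) `^ alpha * (t' - s') `^ alpha.
Proof.
move=> T0; rewrite /covariance_class/= /covariance_norm.
have n1 : (0 <= covariance_norm1 T alpha Q)%E.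
  apply: (@ereal_sup_nonneg _ (`|Q T 0 - Q 0 0| / `|T - 0| `^ alpha)).
    by rewrite divr_ge0// powR_ge0.
  by exists T, 0, 0; split; rewrite ?lexx ?ltW.
have n2 : (0 <= covariance_norm2 T alpha Q)%E.
  apply: (@ereal_sup_nonneg _ (`|Q 0 T - Q 0 0| / `|T - 0| `^ alpha)).
    by rewrite divr_ge0// powR_ge0.
  by exists 0, T, 0; split; rewrite ?lexx ?ltW.
have n3 : (0 <= covariance_norm3 T alpha Q)%E.
  apply: (@ereal_sup_nonneg _ (`|rect_incr Q 0 0 T T| / (`|T - 0| * `|T - 0|) `^ alpha)).
    by rewrite divr_ge0// powR_ge0.
  by exists T, 0, T, 0; split.
move=> fin.
have f3 : (covariance_norm3 T alpha Q < +oo)%E.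
  by apply: le_lt_trans fin; rewrite leeDr// adde_ge0.
have [C C0 Q3] := ereal_sup_bound n3 f3.
(* The supremum covers nondegenerate rectangles; on a degenerate one the increment is 0. *)
exists C => // s t s' t' s0; rewrite le_eqVlt => /predU1P[->|st] tT s'0.
  move=> _ _; rewrite /rect_incr [X in `|X|](_ : _ = 0).
    by rewrite normr0 !mulr_ge0// powR_ge0.
  by rewrite addrAC subrK subrr.
rewrite le_eqVlt => /predU1P[->|st'] tT'.
  rewrite /rect_incr subrr add0r addNr normr0.
  by rewrite !mulr_ge0// powR_ge0.
rewrite -mulrA -powRM ?subr_ge0 ?(ltW st) ?(ltW st')//.
rewrite -ler_pdivrMr ?powR_gt0 ?mulr_gt0 ?subr_gt0//.
apply: Q3; exists t, s, t', s'; split => //.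
by rewrite !gtr0_norm ?subr_gt0.
Qed.

End class_bounds.

Lemma rect_incrE (R : realType) (V : zmodType) (f : R -> R -> V) (s s' t t' : R) :
  rect_incr f s s' t t' = (f t t' - f t s') - (f s t' - f s s').
Proof. by rewrite /rect_incr opprB addrA addrAC. Qed.

Lemma rect_incrE' (R : realType) (V : zmodType) (f : R -> R -> V) (s s' t t' : R) :
  rect_incr f s s' t t' = (f t t' - f s t') - (f t s' - f s s').
Proof. by rewrite /rect_incr opprB addrA [RHS]addrAC (addrAC (f t t')). Qed.

(** * Convergence of the single and double sums *)

Section convergence.
Context (R : realType) (H : hilbertType R).
Implicit Types (K Q : R -> R -> boundedOp H) (w : R -> H).

(** One constant serves the action on vectors and both multiplications on operators, since the
    operator norm is submultiplicative and the adjoint does not increase it. The last two kernels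
    are the two sides of the double sum. *)
Lemma singular_kernel_ops (T eta : R) K : 0 < T -> kernel_class T eta K ->
  exists2 C, 0 <= C & forall tau, tau <= T ->
    [/\ singular_kernel tau eta C (fun u (x : H) => K tau u x),
      singular_kernel tau eta C (fun u (A : boundedOp H) => opcomp (K tau u) A) &
      singular_kernel tau eta C
        (fun u (A : boundedOp H) => opcomp A (adjoint (K tau u)))].
Proof.
move=> T0 /(kernel_class_bounds T0)[C [C0 K1 K2]]; exists C => // tau tauT.
split; split => [u x y|u x u0 ut|a m x a0 am mt].
- exact: boundedOpB.
- by apply: le_trans (le_boundedOp _ _) _; rewrite ler_wpM2r// K1.
- apply: le_trans (le_boundedOp (K tau a - K tau m) x) _.
  by rewrite ler_wpM2r// distrC K2.
- exact: opcompBr.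
- by apply: le_trans (opcomp_norm_le _ _) _; rewrite ler_wpM2r// K1.
- rewrite -opcompBl; apply: le_trans (opcomp_norm_le _ _) _.
  by rewrite ler_wpM2r// distrC K2.
- exact: opcompBl.
- apply: le_trans (opcomp_norm_le _ _) _; rewrite mulrC ler_wpM2r//.
  by apply: le_trans (adjoint_norm_le _) _; exact: K1.
- rewrite -opcompBr -adjointB; apply: le_trans (opcomp_norm_le _ _) _.
  rewrite mulrC ler_wpM2r// (le_trans (adjoint_norm_le _))//.
  by rewrite distrC K2.
Qed.

Lemma small_powR (B g e : R) : 0 <= B -> 0 < g -> 0 < e ->
  exists2 delta, 0 < delta & B * delta `^ g < e.
Proof.
move=> B0 g0 e0; have B1 : 0 < B + 1 by rewrite ltr_wpDl.
have eB : 0 < e / (B + 1) by rewrite divr_gt0.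
exists ((e / (B + 1)) `^ g^-1); first exact: powR_gt0.
rewrite -powRrM mulVf ?gt_eqF// powRr1 ?(ltW eB)//.
by rewrite mulrCA gtr_pMr// ltr_pdivrMr// mul1r ltrDl.
Qed.

Lemma volterra_cvg (T eta beta : R) K w (tau t : R) : 0 < T ->
  kernel_class T eta K -> 0 < eta -> eta < beta ->
  hoelder_on beta `[0, T] w -> 0 <= t -> t <= tau -> tau <= T ->
  volterra_sum K w tau @ mesh_to0 t --> volterra_integral K w tau t.
Proof.
move=> T0 /(singular_kernel_ops T0)[C C0 hK] eta0 eb [M wM] t0 t_tau tauT.
have [hk _ _] := hK _ tauT.
have hw : hoelder_path t `|M| beta w.
  move=> x y x0 xy yt; apply: (@le_trans _ _ (M * `|y - x| `^ beta)).
    by apply: wM; rewrite /= in_itv/=; lra.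
  by rewrite ger0_norm ?subr_ge0// ler_wpM2r ?powR_ge0// ler_norm.
pose gamma := (beta - eta) / 2.
have g0 : 0 < gamma by rewrite /gamma; lra.
have bE : beta = eta + gamma + gamma by rewrite /gamma; lra.
have FF := mesh_to0_proper t0.
suff : cvg (volterra_sum K w tau @ mesh_to0 t) by [].
apply/cauchy_cvgP; apply: cauchy_exP => e e0.
have B0 : 0 <= C * `|M| / gamma * tau `^ gamma *+ 2.
  by apply: mulrn_wge0; apply: mulr_ge0;
    [apply: divr_ge0; [exact: mulr_ge0|exact: ltW]|exact: powR_ge0].
have [delta d0 hd] := small_powR B0 g0 e0.
have mA : mesh_to0 t [set s | itv_partition 0 t s /\ mesh s < delta] by exists delta.
have [s [ps sd]] := @filter_ex _ _ FF _ mA.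
exists (volterra_sum K w tau s); exists delta => // s' [ps' s'd].
rewrite /= -ball_normE/=.
have E u : volterra_sum K w tau u = germ_sum (path_germ (fun u x => K tau u x) w) 0 u.
  exact: (germ_sumE (path_germ (fun u x => K tau u x) w)).
rewrite !E; apply: le_lt_trans hd.
have := path_germ_sum_close t_tau eta0 g0 bE C0 (normr_ge0 M) hk hw ps ps' (ltW sd) (ltW s'd).
move/le_trans; apply; rewrite le_eqVlt; apply/orP; left; apply/eqP; ring.
Qed.

(** For a fixed partition of one variable, the double sum is a single Volterra sum of an
    operator-valued path in the other variable. Two pairs of partitions are compared by changing one
    component at a time, at a cost of 2 units each, hence the factor 4. *)
Lemma double_cvg (T eta alpha : R) K Q (tau t : R) : 0 < T ->
  kernel_class T eta K -> 0 < eta -> eta < alpha ->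
  covariance_class T alpha Q -> 0 <= t -> t <= tau -> tau <= T ->
  (fun p => double_sum K Q tau p.1 p.2) @ (mesh_to0 t, mesh_to0 t) -->
  double_integral K Q tau t.
Proof.
move=> T0 /(singular_kernel_ops T0)[C C0 hK] eta0 ea.
move=> /(covariance_class_bound T0)[D D0 hQ] t0 t_tau tauT.
have [_ hl hr] := hK _ tauT.
pose kl u A := opcomp (K tau u) A.
pose kr u A := opcomp A (adjoint (K tau u)).
pose gamma := (alpha - eta) / 2.
have g0 : 0 < gamma by rewrite /gamma; lra.
have aE : alpha = eta + gamma + gamma by rewrite /gamma; lra.
pose c := tau `^ (gamma + gamma) * (1 + gamma^-1).
have c0 : 0 <= c by rewrite mulr_ge0 ?powR_ge0// addr_ge0// invr_ge0 ltW.
pose Fr s' x := germ_sum (path_germ kr (Q x)) 0 s'.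
pose Fl s y := germ_sum (path_germ kl (Q ^~ y)) 0 s.
have DE s s' : double_sum K Q tau s s' =
    germ_sum (fun a b => germ_sum (fun a' b' =>
      opcomp (opcomp (K tau a) (rect_incr Q a a' b b')) (adjoint (K tau a'))) 0 s') 0 s.
  rewrite /double_sum -germ_sumE; apply: eq_bigr => i _.
  by rewrite -germ_sumE.
have DEr s s' : double_sum K Q tau s s' = germ_sum (path_germ kl (Fr s')) 0 s.
  rewrite DE; apply: eq_germ_sum => a b.
  rewrite /path_germ /Fr germ_sumB.
  rewrite (@germ_sum_morph _ _ _ (kl a)) /kl; last 2 first.
  - by apply: boundedOp_ext => x; rewrite /= boundedOp0r.
  - exact: opcompDr.
  apply: eq_germ_sum => a' b'; rewrite /path_germ /kr -opcompBl.
  by rewrite opcompA rect_incrE.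
have DEl s s' : double_sum K Q tau s s' = germ_sum (path_germ kr (Fl s)) 0 s'.
  rewrite DE germ_sum_exchange; apply: eq_germ_sum => a' b'.
  rewrite /path_germ /Fl germ_sumB.
  rewrite (@germ_sum_morph _ _ _ (kr a')) /kr; last 2 first.
  - exact: boundedOp_ext.
  - by move=> A B; exact: opcompDl.
  apply: eq_germ_sum => a b; rewrite /path_germ /kl -opcompBr.
  by rewrite rect_incrE'.
(* The increment of [Fr s'] between [x] and [y] is the sum for the path [z |-> Q y z - Q x z]. The
   rectangular norm makes that path Hoelder with constant [D (y - x)^alpha], and the uniform bound
   on single sums removes the dependence on [s']. *)
have hFr s' : itv_partition 0 t s' -> hoelder_path t (C * D * c) alpha (Fr s').
  move=> ps' x y x0 xy yt; rewrite /Fr germ_sumB.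
  rewrite (@eq_germ_sum _ _ _ (path_germ kr (fun z => Q y z - Q x z))); last first.
    move=> a b; rewrite /path_germ /kr -opcompBl; congr (opcomp _ _).
    by rewrite !opprB [RHS]addrACA [LHS]addrACA; congr (_ + _); rewrite addrC.
  have hw : hoelder_path t (D * (y - x) `^ alpha) alpha (fun z => Q y z - Q x z).
    move=> a b a0 ab bt.
    rewrite -rect_incrE'.
    by apply: hQ => //; lra.
  have := path_germ_sum_bound t_tau eta0 g0 aE C0 _ hr hw ps'.
  rewrite mulr_ge0 ?powR_ge0// => /(_ isT)/le_trans; apply.
  by rewrite -/c le_eqVlt; apply/orP; left; apply/eqP; ring.
have hFl s : itv_partition 0 t s -> hoelder_path t (C * D * c) alpha (Fl s).
  move=> ps x y x0 xy yt; rewrite /Fl germ_sumB.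
  rewrite (@eq_germ_sum _ _ _ (path_germ kl (fun z => Q z y - Q z x))); last first.
    move=> a b; rewrite /path_germ /kl -opcompBr; congr (opcomp _ _).
    by rewrite !opprB [RHS]addrACA [LHS]addrACA; congr (_ + _); rewrite addrC.
  have hw : hoelder_path t (D * (y - x) `^ alpha) alpha (fun z => Q z y - Q z x).
    move=> a b a0 ab bt.
    rewrite -rect_incrE.
    by rewrite mulrAC; apply: hQ => //; lra.
  have := path_germ_sum_bound t_tau eta0 g0 aE C0 _ hl hw ps.
  rewrite mulr_ge0 ?powR_ge0// => /(_ isT)/le_trans; apply.
  by rewrite -/c le_eqVlt; apply/orP; left; apply/eqP; ring.
have FF := mesh_to0_proper t0.
suff : cvg ((fun p => double_sum K Q tau p.1 p.2) @ (mesh_to0 t, mesh_to0 t)) by [].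
apply: boundedOp_cauchy_cvg => e e0.
have M0 : 0 <= C * D * c by apply: mulr_ge0 => //; exact: mulr_ge0.
have B0 : 0 <= C * (C * D * c) / gamma * tau `^ gamma *+ 4.
  by apply: mulrn_wge0; apply: mulr_ge0;
    [apply: divr_ge0; [exact: mulr_ge0|exact: ltW]|exact: powR_ge0].
have [delta d0 hd] := small_powR B0 g0 e0.
pose A := [set s | itv_partition 0 t s /\ mesh s < delta].
have mA : mesh_to0 t A by exists delta.
exists (A `*` A, A `*` A); first by split; exists (A, A).
move=> [[s s'] [r r']] [[/= [ps sd] [ps' sd']] [[pr rd] [pr' rd']]] /=.
apply: le_lt_trans hd; apply: le_trans (ler_distD (double_sum K Q tau r s') _ _) _.
have h1 := path_germ_sum_close t_tau eta0 g0 aE C0 M0 hl (hFr _ ps') ps pr (ltW sd) (ltW rd).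
have h2 := path_germ_sum_close t_tau eta0 g0 aE C0 M0 hr (hFl _ pr) ps' pr' (ltW sd') (ltW rd').
rewrite -!DEr in h1; rewrite -!DEl in h2.
apply: le_trans (lerD h1 h2) _.
by rewrite le_eqVlt; apply/orP; left; apply/eqP; ring.
Qed.

End convergence.

(** * Real Gaussian variables *)

Section law_uniqueness.
Context (R : realType).
Local Notation mu := (@lebesgue_measure R).

(** A continuous function that descends with slope [-k] to the value 0 at [a], so that the limit in
    [k] is the indicator of the half-line open at [a]. *)
Definition ramp (a : R) (k : nat) (x : R) : R := Num.min 1 (k%:R * Num.max 0 (a - x)).

Lemma continuous_ramp a k : continuous (ramp a k).
Proof.
move=> x; apply: (@continuous_min R R (cst 1) (fun x => k%:R * Num.max 0 (a - x))).
  exact: cst_continuous.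
apply: continuousM; first exact: cst_continuous.
apply: (@continuous_max R R (cst 0) (fun x => a - x)); first exact: cst_continuous.
by apply: continuousB; [exact: cst_continuous|].
Qed.

Lemma ramp_itv a k x : 0 <= ramp a k x <= 1.
Proof. by rewrite /ramp le_min ler01 ge_min lexx/= mulr_ge0// le_max lexx. Qed.

Lemma cvg_ramp a x : ramp a k x @[k --> \oo] --> (\1_(`]-oo, a[ : set R) x : R).
Proof.
rewrite indicE; case: (boolP (x \in _)); rewrite ?inE ?notin_setE/= in_itv/=.
  move=> xa; apply: (@cvg_near_cst _ _ _ _ _ _); near=> k.
  have h : 0 < a - x by rewrite subr_gt0.
  rewrite /ramp (max_idPr _) ?(ltW h)//; apply/min_idPl.
  rewrite -ler_pdivrMr// div1r.
  by near: k; apply: nbhs_infty_ger.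
move=> /negP; rewrite -leNgt => ax; apply: cvg_near_cst; near=> k.
by rewrite /ramp (max_idPl _) ?subr_le0// mulr0 (min_idPr _).
Unshelve. all: by end_near. Qed.

(** Dominated convergence along the ramps gives the masses of the open left half-lines, which are
    stable under intersection and generate the Borel sets. *)
Lemma eq_probability (P1 P2 : probability (measurableTypeR R) R) :
  (forall f : R -> R, continuous f -> (forall x, 0 <= f x <= 1) ->
    (\int[P1]_x (f x)%:E = \int[P2]_x (f x)%:E)%E) ->
  forall A, measurable A -> P1 A = P2 A.
Proof.
move=> P12.
have half a : P1 `]-oo, a[%classic = P2 `]-oo, a[%classic.
  have lim (Q : probability (measurableTypeR R) R) :
      (\int[Q]_x (ramp a k x)%:E)%E @[k --> \oo] --> Q `]-oo, a[%classic.
    rewrite (_ : Q `]-oo, a[%classic = \int[Q]_x (\1_(`]-oo, a[ : set R) x)%:E)%E; last first.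
      by rewrite integral_indic// setIT.
    apply: (@dominated_cvg _ _ _ Q _ measurableT _ _ (cst 1%E)) => //.
    - move=> k; apply/measurable_EFinP; apply: continuous_measurable_fun.
      exact: continuous_ramp.
    - by move=> x _; apply/fine_cvgP; split; [exact: nearW|exact: cvg_ramp].
    - exact: finite_measure_integrable_cst.
    - move=> k x _; rewrite lee_fin ger0_norm; by case/andP: (ramp_itv a k x).
  have := lim P1.
  rewrite (_ : (fun k => _) = (fun k => \int[P2]_x (ramp a k x)%:E)%E).
    by move=> h; apply: (cvg_unique _ h (lim P2)).
  by apply/funext => k; apply: P12; [exact: continuous_ramp|exact: ramp_itv].
move=> A mA; apply: (@measure_unique _ R (measurableTypeR R) (@RGenInftyO.G R)
  (fun n => `]-oo, n%:R[%classic)) => //.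
- exact: RGenInftyO.measurableE.
- move=> _ _ [a ->] [b ->]; exists (Num.min a b).
  apply/seteqP; split => x /=; rewrite !in_itv/= lt_min.
    by case=> -> ->.
  by move=> /andP[].
- by move=> n; exists n%:R.
- apply/seteqP; split => // x _; exists (Num.truncn x).+1 => //=.
  by rewrite in_itv/= truncnS_gt.
- by move=> _ [a ->]; exact: half.
- move=> n; apply: le_lt_trans (probability_le1 _ _) _ => //.
  by rewrite ltry.
Qed.

(** Both functions have the same integral over every measurable set. This lets the abstract
    Radon-Nikodym change of variables be used with the explicit density. *)
Lemma ae_eq_normal_density (m s : R) :
  ae_eq mu setT (Radon_Nikodym_SigmaFinite.f (normal_prob m s) mu)
    (EFin \o normal_pdf m s).
Proof.
have dom := normal_prob_dominates m s.
apply: integral_ae_eq => //.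
- exact: Radon_Nikodym_SigmaFinite.f_integrable.
- by apply/measurable_EFinP; exact: measurable_normal_pdf.
- by move=> A _ mA; rewrite -Radon_Nikodym_SigmaFinite.f_integral.
Qed.

Lemma ge0_integral_normal (m s : R) (f : R -> \bar R) :
  measurable_fun setT f -> (forall x, 0 <= f x)%E ->
  (\int[normal_prob m s]_x f x = \int[mu]_x (f x * (normal_pdf m s x)%:E))%E.
Proof.
move=> mf f0; have dom := normal_prob_dominates m s.
rewrite -(Radon_Nikodym_SigmaFinite.change_of_variables dom)//.
apply: ae_eq_integral => //.
- apply: emeasurable_funM => //.
  exact: measurable_int (Radon_Nikodym_SigmaFinite.f_integrable dom).
- by apply: emeasurable_funM => //; apply/measurable_EFinP; exact: measurable_normal_pdf.
- by apply: ae_eqe_mul2l; exact: ae_eq_normal_density.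
Qed.

Lemma integrable_normal (m s : R) (f : R -> R) : measurable_fun setT f ->
  (normal_prob m s).-integrable setT (EFin \o f) <->
  mu.-integrable setT (fun x => (f x * normal_pdf m s x)%:E).
Proof.
move=> mf.
have E : (\int[normal_prob m s]_x `|(f x)%:E| = \int[mu]_x `|(f x * normal_pdf m s x)%:E|)%E.
  rewrite ge0_integral_normal//; last first.
    by apply: measurableT_comp => //; exact/measurable_EFinP.
  apply: eq_integral => x _; rewrite /= normrM EFinM.
  by rewrite (ger0_norm (normal_pdf_ge0 _ _ _)).
split => /integrableP[_ h]; apply/integrableP; split.
- apply/measurable_EFinP; apply: measurable_funM => //; exact: measurable_normal_pdf.
- by rewrite -E.
- exact/measurable_EFinP.
- by rewrite /= E.
Qed.

Lemma integral_normal (m s : R) (f : R -> R) : measurable_fun setT f ->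
  (normal_prob m s).-integrable setT (EFin \o f) ->
  (\int[normal_prob m s]_x (f x)%:E = \int[mu]_x (f x * normal_pdf m s x)%:E)%E.
Proof.
move=> mf fi; have fi' := (integrable_normal _ _ mf).1 fi.
rewrite integralE [RHS]integralE; congr (_ - _)%E; rewrite ge0_integral_normal//.
- apply: eq_integral => x _; rewrite !funeposE -!EFin_max -EFinM maxr_pMl ?mul0r//.
  exact: normal_pdf_ge0.
- exact/measurable_funepos/measurable_EFinP.
- apply: eq_integral => x _; rewrite !funenegE -!EFinN -!EFin_max -EFinM maxr_pMl ?mul0r ?mulNr//.
  exact: normal_pdf_ge0.
- exact/measurable_funeneg/measurable_EFinP.
Qed.

End law_uniqueness.

(** * Stein's identity and trigonometric integrals of the standard normal *)

Section standard_normal.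
Context (R : realType).
Local Notation mu := (@lebesgue_measure R).
Local Notation N01 := (normal_prob (0 : R) 1).
Local Notation phi := (normal_pdf (0 : R) 1).

(** By the fundamental theorem of calculus the integral over [[-n-1, n+1]] is a difference of
    boundary values of size [O(1/n)]; integrability of [f] allows the passage to the whole line. *)
Lemma integral_derivative_vanishing (F f : R -> R) (C : R) :
  (forall x : R, is_derive x (1 : R) F (f x)) -> continuous f ->
  mu.-integrable setT (EFin \o f) ->
  (forall x, 1 <= `|x| -> `|F x| <= C / `|x|) ->
  (\int[mu]_x (f x)%:E = 0)%E.
Proof.
move=> dF cf intf FC.
pose I (n : nat) := `[- n.+1%:R, n.+1%:R]%classic : set R.
have mf : measurable_fun setT f by exact: continuous_measurable_fun.
have FTC n : (\int[mu]_x (f x * \1_(I n) x)%:E = (F n.+1%:R - F (- n.+1%:R))%:E)%E.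
  transitivity (\int[mu]_(x in I n) (f x)%:E)%E.
    rewrite [RHS]integral_mkcond/=; apply: eq_integral => x _.
    rewrite patchE indicE; case: ifPn => xI; first by rewrite mulr1.
    by rewrite mulr0.
  rewrite (@continuous_FTC2 _ f F).
  - by rewrite EFinB.
  - by rewrite -subr_gt0 opprK addr_gt0.
  - exact: continuous_subspaceT.
  - split; first by move=> x _; have [] := dF x.
    + apply: cvg_at_right_filter; apply: differentiable_continuous.
      by apply/derivable1_diffP; have [] := dF (- n.+1%:R).
    + apply: cvg_at_left_filter; apply: differentiable_continuous.
      by apply/derivable1_diffP; have [] := dF n.+1%:R.
  - by move=> x _; rewrite derive1E; have [_ ->] := dF x.
have lim1 : (\int[mu]_x (f x * \1_(I n) x)%:E)%E @[n --> \oo] --> (\int[mu]_x (f x)%:E)%E.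
  apply: (@dominated_cvg _ _ _ mu _ measurableT _ _ (abse \o (EFin \o f))) => //.
  - move=> n; apply/measurable_EFinP; apply: measurable_funM => //.
    by apply: measurable_indic; exact: measurable_itv.
  - move=> x _; apply: cvg_near_cst; near=> n.
    rewrite indicE mem_set ?mulr1// /I/= in_itv/=.
    suff : `|x| <= n.+1%:R by rewrite ler_norml.
    near: n; exists (Num.truncn `|x|) => // n /= xn.
    by rewrite ltW// (lt_le_trans (truncnS_gt _))// ler_nat.
  - exact: integrable_abse.
  - move=> n x _; rewrite /= lee_fin normrM ler_piMr// indicE.
    by case: (_ \in _); rewrite ?normr1 ?normr0.
have lim2 : (\int[mu]_x (f x * \1_(I n) x)%:E)%E @[n --> \oo] --> 0%E.
  under eq_fun do rewrite FTC.
  apply/fine_cvgP; split; first exact: nearW.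
  rewrite /comp/=; apply: norm_cvg0.
  have h : (C * 2) * n.+1%:R^-1 @[n --> \oo] --> (C * 2) * (0 : R).
    by apply: cvgM; [exact: cvg_cst|exact: cvg_harmonic].
  rewrite mulr0 in h; apply: squeeze_cvgr h; last exact: cvg_cst.
  apply: nearW => n; rewrite normr_ge0/=.
  have n1 : 1 <= `|n.+1%:R : R| by rewrite ger0_norm// ler1n.
  have h1 : `|F n.+1%:R| <= C * n.+1%:R^-1 by rewrite -[X in _ <= _ * X^-1]normr_nat FC.
  have h2 : `|F (- n.+1%:R)| <= C * n.+1%:R^-1.
    by rewrite -[X in _ <= _ * X^-1]normr_nat -[X in _ <= _ * X^-1]normrN FC// normrN.
  by apply: le_trans (ler_normB _ _) _; rewrite mulrAC mulr_natr mulr2n lerD.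
exact: (cvg_unique _ lim1 lim2).
Unshelve. all: by end_near. Qed.

Let phiE x : phi x = normal_peak 1 * expR (- (x ^+ 2) / 2).
Proof.
by rewrite normal_pdfE ?oner_eq0// /normal_fun subr0 expr1n mulr2n.
Qed.

Let phi_ge0 x : 0 <= phi x. Proof. exact: normal_pdf_ge0. Qed.

Let is_derive_phi (x : R) : is_derive x (1 : R) phi (- x * phi x).
Proof.
have -> : phi = (fun x => normal_peak 1 * expR (- (x ^+ 2) / 2)).
  by apply/funext => z; rewrite phiE.
have h : is_derive x (1 : R) (fun x : R => - (x ^+ 2) / 2) (- x).
  apply: is_derive_eq; rewrite /GRing.scale/=; lra.
apply: is_derive_eq; rewrite /GRing.scale/=; ring.
Qed.

Let continuous_phi : continuous phi.
Proof. by apply: continuous_normal_pdf; rewrite oner_eq0. Qed.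

Let p1 : R := normal_peak 1.

Let p1_ge0 : 0 <= p1. Proof. exact: normal_peak_ge0. Qed.

(** Split [1/2 = 1/8 + 3/8]. The factor [exp (3 x^2 / 8) >= 1 + 3 x^2 / 8] absorbs [1 + x^2] with
    ratio at most 8/3, for which 6 is a generous bound; what remains is proportional to the normal
    density of standard deviation 2. *)
Let sqr_phi_bound x : (1 + x ^+ 2) * phi x <= 6 * p1 * expR (- (x ^+ 2) / 8).
Proof.
rewrite phiE -/p1.
have -> : - (x ^+ 2) / 2 = - (x ^+ 2) / 8 + - (3 / 8 * x ^+ 2) by lra.
rewrite expRD expRN.
have h := expR_ge1Dx (3 / 8 * x ^+ 2); have x2 := sqr_ge0 x.
have -> : (1 + x ^+ 2) * (p1 * (expR (- (x ^+ 2) / 8) * (expR (3 / 8 * x ^+ 2))^-1)) =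
  p1 * expR (- (x ^+ 2) / 8) * ((1 + x ^+ 2) / expR (3 / 8 * x ^+ 2)) by ring.
have -> : 6 * p1 * expR (- (x ^+ 2) / 8) = p1 * expR (- (x ^+ 2) / 8) * 6 by ring.
rewrite ler_wpM2l//; first by rewrite mulr_ge0// expR_ge0.
rewrite ler_pdivrMr ?expR_gt0//; lra.
Qed.

Lemma std_normal_integrable (f : R -> R) (A : R) : measurable_fun setT f ->
  (forall x, `|f x| <= A * (1 + x ^+ 2)) -> N01.-integrable setT (EFin \o f).
Proof.
move=> mf fA; apply/integrable_normal => //.
have A0 : 0 <= A.
  by have := fA 0; rewrite expr0n addr0 mulr1; exact: le_trans.
have p2 : 0 < normal_peak (2 : R) by rewrite normal_peak_gt0.
pose c := A * (6 * p1 / normal_peak 2).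
apply: (@le_integrable _ _ _ mu setT _ _ (fun x => c%:E * (normal_pdf 0 2 x)%:E)%E) => //.
- apply/measurable_EFinP/measurable_funM => //; exact: measurable_normal_pdf.
- move=> x _; rewrite -EFinM /= lee_fin normrM (ger0_norm (phi_ge0 x)).
  apply: le_trans (ler_norm _).
  apply: (@le_trans _ _ (A * ((1 + x ^+ 2) * phi x))).
    by rewrite mulrA ler_wpM2r.
  rewrite -mulrA; apply: ler_wpM2l => //; apply: le_trans (sqr_phi_bound x) _.
  rewrite normal_pdfE// /normal_fun subr0 mulrA divfK ?gt_eqF//.
  have -> : (2 : R) ^+ 2 *+ 2 = 8 by rewrite expr2; ring.
  by [].
- by apply: integrableZl => //; exact: integrable_normal_pdf.
Qed.

(** Since [phi' = - x phi], the integrand times [phi] is the derivative of [g phi], which vanishes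
    at infinity. *)
Lemma std_normal_stein (g g' : R -> R) (B : R) :
  (forall x : R, is_derive x (1 : R) g (g' x)) -> continuous g' ->
  (forall x, `|g x| <= 1 + `|x|) -> (forall x, `|g' x| <= B) ->
  (\int[N01]_x (g' x - x * g x)%:E = 0)%E.
Proof.
move=> dg cg' gb g'b.
have cg : continuous g.
  move=> x; apply: differentiable_continuous.
  by apply/derivable1_diffP; have [] := dg x.
have ch : continuous (fun x => g' x - x * g x).
  by move=> x; apply: cvgB; [exact: cg'|apply: cvgM; [exact: cvg_id|exact: cg]].
have mh := continuous_measurable_fun ch.
have hb x : `|g' x - x * g x| <= (B + 2) * (1 + x ^+ 2).
  apply: le_trans (ler_normB _ _) _; rewrite normrM.
  have h1 := g'b x; have h2 := gb x; have h3 := normr_ge0 x.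
  have B0 : 0 <= B by exact: le_trans (normr_ge0 _) h1.
  have : `|x| * `|g x| <= `|x| * (1 + `|x|) by rewrite ler_wpM2l.
  rewrite -[x ^+ 2]real_normK ?num_real//; move: (`|x|) h3 => y y0 h4.
  have := sqr_ge0 (y - 1); have : 0 <= B * y ^+ 2 by rewrite mulr_ge0 ?sqr_ge0.
  rewrite sqrrB !expr2; nra.
have hi := std_normal_integrable mh hb.
rewrite integral_normal//.
(* 12 is 2 times the 6 of [sqr_phi_bound]: [(1 + |x|) |x| <= 2 (1 + x^2)]. *)
apply: (@integral_derivative_vanishing (fun x => g x * phi x) _ (12 * p1)).
- move=> x; have := is_derive_phi x; have := dg x => ? ?.
  apply: is_derive_eq; rewrite /GRing.scale/=; ring.
- by move=> x; apply: cvgM; [exact: ch|exact: continuous_phi].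
- exact/integrable_normal.
move=> x x1; have x0 : 0 < `|x| by exact: lt_le_trans x1.
rewrite ler_pdivlMr// normrM (ger0_norm (phi_ge0 x)).
apply: (@le_trans _ _ (2 * ((1 + x ^+ 2) * phi x))).
  rewrite mulrAC mulrA ler_wpM2r//.
  apply: (@le_trans _ _ ((1 + `|x|) * `|x|)); first by rewrite ler_wpM2r// ltW.
  by rewrite -[x ^+ 2]real_normK ?num_real// expr2; nra.
have := sqr_phi_bound x; have : expR (- (x ^+ 2) / 8) <= 1.
  by rewrite -expR0 ler_expR mulNr oppr_le0 divr_ge0// sqr_ge0.
move=> e1 h; apply: (@le_trans _ _ (2 * (6 * p1 * 1))).
  by apply: ler_wpM2l => //; apply: le_trans h _; apply: ler_wpM2l => //; rewrite mulr_ge0.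
by rewrite mulr1 mulrA -natrM.
Qed.

Lemma std_normal_mean : (\int[N01]_x x%:E = 0)%E.
Proof.
rewrite -(@std_normal_stein (cst (-1)) (cst 0) 0).
- by apply: eq_integral => x _; rewrite /= mulrN1 opprK add0r.
- exact: cst_continuous.
- by move=> x; rewrite normrN1 lerDl.
- by move=> x; rewrite normr0.
Qed.

Lemma std_normal_variance : (\int[N01]_x (x ^+ 2)%:E = 1)%E.
Proof.
have i2 : N01.-integrable setT (EFin \o (fun x : R => x ^+ 2)).
  apply: (@std_normal_integrable _ 1); first exact: measurable_funX.
  by move=> x; rewrite mul1r ger0_norm ?sqr_ge0// lerDr.
have i1 : N01.-integrable setT (EFin \o (fun x : R => 1)).
  by apply: (@std_normal_integrable _ 1) => // x; rewrite mul1r normr1 lerDl sqr_ge0.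
have : (\int[N01]_x (1%:E - (x ^+ 2)%:E) = 0)%E.
  rewrite -(@std_normal_stein id (cst 1) 1).
  - by apply: eq_integral => x _; rewrite /= expr2 EFinB.
  - exact: cst_continuous.
  - by move=> x; rewrite lerDr.
  - by move=> x; rewrite normr1.
have e1 : (\int[N01]_x 1%:E = 1)%E.
  by rewrite integral_cst// mul1e; exact: (@probability_setT _ _ _ N01).
rewrite integralB//= e1.
have /fineK <- := integrable_fin_num measurableT i2.
by rewrite -EFinB => -[] h; congr EFin; lra.
Qed.

Let integrable_cos t c : N01.-integrable setT (EFin \o (fun x : R => cos (t * x + c))).
Proof.
apply: (@std_normal_integrable _ 1).
  apply: continuous_measurable_fun => x.
  apply: continuous_comp; last exact: continuous_cos.
  by apply: cvgD; [apply: cvgM; [exact: cvg_cst|exact: cvg_id]|exact: cvg_cst].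
move=> x; rewrite mul1r; apply: (@le_trans _ _ 1); last by rewrite lerDl sqr_ge0.
by rewrite ler_norml cos_geN1 cos_le1.
Qed.

Let integrable_sin t c : N01.-integrable setT (EFin \o (fun x : R => - x * sin (t * x + c))).
Proof.
apply: (@std_normal_integrable _ 1).
  apply: continuous_measurable_fun => x.
  apply: cvgM; first by apply: cvgN; exact: cvg_id.
  apply: continuous_comp; last exact: continuous_sin.
  by apply: cvgD; [apply: cvgM; [exact: cvg_cst|exact: cvg_id]|exact: cvg_cst].
move=> x; rewrite mul1r normrM normrN; apply: (@le_trans _ _ `|x|).
  by rewrite ler_piMr// ler_norml sin_geN1 sin_le1.
rewrite -[x ^+ 2]real_normK ?num_real//; have := sqr_ge0 (`|x| - 1); have := normr_ge0 x.
rewrite sqrrB !expr2; nra.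
Qed.

(** As a function [h] of the frequency, the integral solves [h' = - s h] with [h 0 = cos c]. *)
Lemma std_normal_cos (t c : R) :
  (\int[N01]_x (cos (t * x + c))%:E = (cos c * expR (- (t ^+ 2) / 2))%:E)%E.
Proof.
pose h s := (\int[N01]_x cos (s * x + c))%R.
have dpart (s x : R) : is_derive s (1 : R) (fun s => cos (s * x + c)) (- x * sin (s * x + c)).
  apply: is_derive_eq; rewrite /GRing.scale/=; ring.
(* Stein's identity for [g x = sin (s x + c)]. *)
have hE s : (\int[N01]_x (- x * sin (s * x + c)))%R = - s * h s.
  have iscos : N01.-integrable setT (EFin \o (fun x : R => s * cos (s * x + c))).
    have -> : EFin \o (fun x : R => s * cos (s * x + c)) =
      (fun x => s%:E * (EFin \o (fun x : R => cos (s * x + c))) x)%E by [].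
    by apply: integrableZl => //; exact: integrable_cos.
  suff : s * h s + (\int[N01]_x (- x * sin (s * x + c)))%R = 0 by lra.
  have e1 : (\int[N01]_x (s * cos (s * x + c)))%R = s * h s.
    by apply: RintegralZl => //; exact: integrable_cos.
  rewrite -e1.
  have <- := RintegralD measurableT iscos (integrable_sin s c).
  rewrite /Rintegral.
  have st : (\int[N01]_x (s * cos (s * x + c) - x * sin (s * x + c))%:E = 0)%E.
    apply: (@std_normal_stein (fun x => sin (s * x + c)) (fun x => s * cos (s * x + c)) `|s|).
    - by move=> x; apply: is_derive_eq; rewrite /GRing.scale/=; ring.
    - move=> x; apply: cvgM; first exact: cvg_cst.
      apply: continuous_comp; last exact: continuous_cos.
      by apply: cvgD; [apply: cvgM; [exact: cvg_cst|exact: cvg_id]|exact: cvg_cst].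
    - move=> x; apply: (@le_trans _ _ 1); last by rewrite lerDl.
      by rewrite ler_norml sin_geN1 sin_le1.
    - by move=> x; rewrite normrM ler_piMr// ler_norml cos_geN1 cos_le1.
  rewrite -[RHS]/(fine 0%E) -st; congr fine.
  by apply: eq_integral => x _; rewrite mulNr.
(* Differentiation under the integral near [s]: the derivative in the frequency is dominated by the
   integrable function [|x|]. *)
have dh s : is_derive s (1 : R) h (- s * h s).
  have us : `]s - 1, s + 1[%classic s.
    by rewrite /= in_itv/= ltrBlDr ltrDl ltr01.
  have part r x : partial1of2 (fun s x : R => cos (s * x + c)) r x = - x * sin (r * x + c).
    by rewrite partial1of2E; have [_ ->] := dpart r x.
  have iG : N01.-integrable setT (EFin \o (fun x : R => `|x|)).
    apply: (@std_normal_integrable _ 1); first by apply: continuous_measurable_fun; exact: norm_continuous.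
    move=> x; rewrite normr_id mul1r -[x ^+ 2]real_normK ?num_real//.
    have := sqr_ge0 (`|x| - 1); have := normr_ge0 x; rewrite sqrrB !expr2; nra.
  have iF r : `]s - 1, s + 1[%classic r ->
      N01.-integrable setT (EFin \o (fun x => cos (r * x + c))).
    by move=> _; exact: integrable_cos.
  have dF r (x : R) : `]s - 1, s + 1[%classic r -> @setT (measurableTypeR R) x ->
      derivable (fun s : R => cos (s * x + c)) r 1.
    by move=> _ _; have [] := dpart r x.
  have bF r (x : R) : `]s - 1, s + 1[%classic r -> @setT (measurableTypeR R) x ->
      `|partial1of2 (fun s x : R => cos (s * x + c)) r x| <= `|x|.
    move=> _ _; rewrite part normrM normrN ler_piMr//.
    by rewrite ler_norml sin_geN1 sin_le1.
  have G0 (x : R) : 0 <= `|x| by [].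
  apply: DeriveDef.
    exact: (derivable_under_integral measurableT us iF dF G0 iG bF).
  rewrite -derive1E (differentiation_under_integral measurableT us iF dF G0 iG bF).
  by rewrite -hE; apply: eq_Rintegral => x _; rewrite part.
have kc : h t * expR (t ^+ 2 / 2) = h 0 * expR (0 ^+ 2 / 2).
  apply: (is_derive_0_is_cst (f := fun s => h s * expR (s ^+ 2 / 2))) => s.
  have ? := dh s.
  have ? : is_derive s (1 : R) (fun s : R => s ^+ 2 / 2) s.
    apply: is_derive_eq; rewrite /GRing.scale/=; lra.
  apply: is_derive_eq; rewrite /GRing.scale/=; move: (h s) => hs; ring.
have h0 : h 0 = cos c.
  rewrite /h; under eq_Rintegral do rewrite mul0r add0r.
  rewrite Rintegral_cst// (_ : fine _ = 1) ?mulr1//.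
  by transitivity (fine (1%E : \bar R)) => //; congr fine; exact: (@probability_setT _ _ _ N01).
have /fineK <- := integrable_fin_num measurableT (integrable_cos t c).
congr EFin; rewrite -[LHS]/(h t).
move: kc; rewrite h0 expr0n mul0r expR0 mulr1 => <-.
by rewrite -mulrA -expRD mulNr subrr expR0 mulr1.
Qed.

End standard_normal.

(** * Gaussian laws as images of the standard normal *)

Section transfer.
Context (R : realType).
Local Notation mu := (@lebesgue_measure R).
Local Notation N01 := (normal_prob (0 : R) 1).

(** The [sigma] of [real_gaussian] may be negative, but the density involves it through its square
    and through whether it is 0. *)
Lemma normal_prob_normr (m s : R) : normal_prob m `|s| = normal_prob m s.
Proof.
apply/funext => A; apply: eq_integral => x _; congr EFin.
by rewrite /normal_pdf normr_eq0 /normal_peak /normal_fun real_normK ?num_real.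
Qed.

Lemma normal_pdf_affine (m s x : R) : 0 < s ->
  normal_pdf m s (m + s * x) * s = normal_pdf 0 1 x.
Proof.
move=> s0; rewrite !normal_pdfE ?oner_eq0 ?gt_eqF// /normal_peak /normal_fun.
rewrite [m + s * x - m]addrC addKr subr0.
have -> : Num.sqrt (s ^+ 2 * pi *+ 2) = s * Num.sqrt (1 ^+ 2 * pi *+ 2).
  rewrite -mulrnAr sqrtrM ?sqr_ge0// sqrtr_sqr ger0_norm ?(ltW s0)//.
  by rewrite expr1n mul1r.
have -> : - (s * x) ^+ 2 / (s ^+ 2 *+ 2) = - x ^+ 2 / (1 ^+ 2 *+ 2).
  rewrite expr1n; field; exact: lt0r_neq0.
by rewrite invfM mulrC !mulrA divff ?gt_eqF// mul1r.
Qed.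

Lemma integral_normal_affine (m s : R) (f : R -> R) : 0 < s ->
  continuous f -> (forall x, 0 <= f x) ->
  (\int[normal_prob m s]_x (f x)%:E = \int[N01]_x (f (m + s * x))%:E)%E.
Proof.
move=> s0 cf f0.
have mf := continuous_measurable_fun cf.
have cf' : continuous (fun x => f (m + s * x)).
  move=> x; apply: continuous_comp; last exact: cf.
  by apply: cvgD; [exact: cvg_cst|apply: cvgM; [exact: cvg_cst|exact: cvg_id]].
have mfE : measurable_fun [set: R] (EFin \o f) by exact/measurable_EFinP.
have mfE' : measurable_fun [set: R] (EFin \o (fun x => f (m + s * x))).
  by apply/measurable_EFinP; exact: continuous_measurable_fun.
rewrite ge0_integral_normal// [RHS]ge0_integral_normal//; last first.
  by move=> x; rewrite lee_fin.
have d1 : (fun x : R => m + s * x)^`()%classic = cst s.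
  apply/funext => x; rewrite derive1E.
  have h : is_derive x (1 : R) (fun x : R => m + s * x) s.
    by apply: is_derive_eq; rewrite /GRing.scale/=; ring.
  by have [_ ->] := h.
have subst := @increasing_ge0_integration_by_substitutionT R (fun x => m + s * x)
    (fun x => f x * normal_pdf m s x).
rewrite d1 in subst.
under eq_integral do rewrite -EFinM.
rewrite subst; first last.
- by move=> x; rewrite mulr_ge0// normal_pdf_ge0.
- move=> x; apply: cvgM; first exact: cf.
  by apply: continuous_normal_pdf; rewrite gt_eqF.
- exact: (cvg_comp _ _ (gt0_cvgMry s0 cvg_id) (cvg_addrl m)).
- exact: (cvg_comp _ _ (gt0_cvgMrNy s0 cvg_id) (cvg_addrl_Ny m)).
- by move=> x; apply: ex_derive.
- exact: is_cvg_cst.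
- exact: is_cvg_cst.
- exact: cst_continuous.
- by move=> x y xy; rewrite ltrD2l ltr_pM2l.
apply: eq_integral => x _; rewrite /= -EFinM; congr EFin.
by rewrite -(normal_pdf_affine m x s0) mulrA.
Qed.


Let affine (m s z : R) := m + s * z.

Let measurable_affine m s :
  measurable_fun setT (affine m s : measurableTypeR R -> measurableTypeR R).
Proof. by apply: measurable_funD => //; exact: measurable_funM. Qed.

(** The change of variables settles continuous test functions, and [eq_probability] passes to all
    Borel sets. *)
Lemma normal_prob_affine (m s : R) : 0 < s -> forall A : set R, measurable A ->
  normal_prob m s A = pushforward N01 (fun z => m + s * z) A.
Proof.
move=> s0; pose affm := isMeasurableFun.Build _ _ (measurableTypeR R) (measurableTypeR R)
  (affine m s) (measurable_affine m s).
pose aff : {mfun measurableTypeR R >-> measurableTypeR R} := HB.pack (affine m s) affm.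
have H := @eq_probability R (normal_prob m s) (distribution N01 aff).
suff K : forall f : R -> R, continuous f -> (forall x, 0 <= f x <= 1) ->
    (\int[normal_prob m s]_x (f x)%:E = \int[distribution N01 aff]_x (f x)%:E)%E.
  by move=> A mA; exact: (H K A mA).
move=> f cf f01.
have mf := continuous_measurable_fun cf.
have f0 x : 0 <= f x by case/andP: (f01 x).
have E := @ge0_integral_distribution _ _ _ _ _ N01 aff (fun x => (f x)%:E).
have mf' : measurable_fun [set: measurableTypeR R] (fun x : R => (f x)%:E).
  exact/measurable_EFinP.
have {}E := E mf' (fun x => f0 x : (0 <= (f x)%:E)%E).
etransitivity; last (symmetry; exact: E).
exact: integral_normal_affine.
Qed.

Context (d : measure_display) (Omega : measurableType d) (P : probability Omega R).

(* The law of [m + s Z] for a standard normal [Z]; unlike [normal_prob] this is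
   a Dirac mass for [s = 0]. *)
Definition gauss_law (m s : R) (Y : Omega -> R) :=
  [/\ 0 <= s, measurable_fun setT Y & forall A : set R, measurable A ->
    pushforward P Y A = pushforward N01 (fun z => m + s * z) A].

Lemma degenerate_law (m : R) (A : set R) :
  pushforward N01 (fun z => m + 0 * z) A = dirac m A.
Proof.
rewrite /pushforward /dirac indicE.
case: (boolP (m \in A)); rewrite ?inE ?notin_setE => mA.
  rewrite (_ : _ @^-1` _ = setT); first exact: (@probability_setT _ _ _ N01).
  by apply/seteqP; split => // x _ /=; rewrite mul0r addr0.
rewrite (_ : _ @^-1` _ = set0) ?measure0//.
by apply/seteqP; split => // x /=; rewrite mul0r addr0.
Qed.

Lemma real_gaussianP (Y : Omega -> R) :
  real_gaussian P Y <-> exists m s, gauss_law m s Y.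
Proof.
split=> [[mY [m [s Ylaw]]]|[m [s [s0 mY Ylaw]]]].
  exists m, `|s|; split => // A mA; rewrite Ylaw//.
  have [->|s0] := eqVneq s 0; first by rewrite normr0 degenerate_law.
  by rewrite -normal_prob_normr normal_prob_affine// normr_gt0.
split => //; exists m, s => A mA; rewrite Ylaw//.
have [->|sn0] := eqVneq s 0; first by rewrite degenerate_law.
by rewrite normal_prob_affine// lt0r sn0.
Qed.

Section gauss_law_theory.
Context (m s : R) (Y : Omega -> R) (hY : gauss_law m s Y).

Let mY : measurable_fun setT (Y : Omega -> measurableTypeR R).
Proof. by case: hY. Qed.

Lemma ge0_gauss_law_integral (f : R -> R) :
  measurable_fun [set: R] f -> (forall x, 0 <= f x) ->
  (\int[P]_w (f (Y w))%:E = \int[N01]_z (f (m + s * z))%:E)%E.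
Proof.
move=> mf f0; have [_ _ law] := hY.
have mf' : measurable_fun [set: measurableTypeR R] (fun x : R => (f x)%:E).
  exact/measurable_EFinP.
have E1 := @ge0_integral_pushforward _ _ _ _ _ _ mY P setT
  (fun x => (f x)%:E) measurableT mf' (fun x _ => f0 x).
have E2 := @ge0_integral_pushforward _ _ _ _ _ _ (measurable_affine m s) N01 setT
  (fun x => (f x)%:E) measurableT mf' (fun x _ => f0 x).
rewrite preimage_setT in E1; rewrite preimage_setT in E2.
etransitivity; first (symmetry; exact: E1).
etransitivity; last exact: E2.
by apply: eq_measure_integral => A mA _; exact: law.
Qed.

Lemma gauss_law_integrable (f : R -> R) : measurable_fun [set: R] f ->
  N01.-integrable setT (EFin \o (fun z => f (m + s * z))) ->
  P.-integrable setT (EFin \o (f \o Y)).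
Proof.
move=> mf /integrableP[_ fi]; apply/integrableP; split.
  apply/measurable_EFinP; apply: measurableT_comp => //; by case: hY.
rewrite /= (@ge0_gauss_law_integral (fun x => `|f x|))//.
by apply: measurableT_comp.
Qed.

Lemma gauss_law_integral (f : R -> R) : measurable_fun [set: R] f ->
  N01.-integrable setT (EFin \o (fun z => f (m + s * z))) ->
  (\int[P]_w (f (Y w))%:E = \int[N01]_z (f (m + s * z))%:E)%E.
Proof.
move=> mf fi.
rewrite integralE [RHS]integralE; congr (_ - _)%E.
  under eq_integral do rewrite funeposE -EFin_max.
  under [RHS]eq_integral do rewrite funeposE -EFin_max.
  rewrite (@ge0_gauss_law_integral (fun x => Num.max (f x) 0))//.
    exact: measurable_maxr.
  by move=> x; rewrite le_max lexx orbT.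
under eq_integral do rewrite funenegE -EFinN -EFin_max.
under [RHS]eq_integral do rewrite funenegE -EFinN -EFin_max.
rewrite (@ge0_gauss_law_integral (fun x => Num.max (- f x) 0))//.
  by apply: measurable_maxr => //; exact: measurableT_comp.
by move=> x; rewrite le_max lexx orbT.
Qed.

End gauss_law_theory.

End transfer.

(** * Moments and almost sure limits of Gaussian variables *)

Section gauss_moments.
Context (R : realType) (d : measure_display) (Omega : measurableType d).
Context (P : probability Omega R).
Local Notation N01 := (normal_prob (0 : R) 1).

Lemma sqr_affine_le (m s z : R) : (m + s * z) ^+ 2 <= ((m ^+ 2 + s ^+ 2) *+ 2) * (1 + z ^+ 2).
Proof.
have h1 := sqr_ge0 (m - s * z); have h2 := sqr_ge0 s; have h3 := sqr_ge0 (m * z).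
move: h1 h2 h3; rewrite sqrrB sqrrD !exprMn; set a := m ^+ 2; set b := s ^+ 2.
set c := z ^+ 2; set e := m * (s * z); lra.
Qed.

Lemma gauss_law_sqr_integrable m s (Y : Omega -> R) : gauss_law P m s Y ->
  P.-integrable setT (EFin \o (fun w => Y w ^+ 2)).
Proof.
move=> hY; apply: (gauss_law_integrable hY (f := fun x => x ^+ 2)).
  exact: measurable_funX.
apply: (@std_normal_integrable _ _ ((m ^+ 2 + s ^+ 2) *+ 2)).
  apply: measurable_funX; apply: measurable_funD => //; exact: measurable_funM.
by move=> z; rewrite ger0_norm ?sqr_ge0// sqr_affine_le.
Qed.

Lemma std_affine_integrable (m s : R) :
  N01.-integrable setT (EFin \o (fun z => m + s * z)).
Proof.
apply: (@std_normal_integrable _ _ (`|m| + `|s|)).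
  apply: measurable_funD => //; exact: measurable_funM.
move=> z; apply: le_trans (ler_normD _ _) _; rewrite mulrDl normrM lerD//.
  by rewrite ler_peMr// lerDl sqr_ge0.
rewrite ler_wpM2l// -[z ^+ 2]real_normK ?num_real//; have := sqr_ge0 (`|z| - 1).
by rewrite sqrrB expr1n mulr1; have := normr_ge0 z; lra.
Qed.

Lemma gauss_law_mean m s (Y : Omega -> R) : gauss_law P m s Y ->
  ('E_P[Y] = m%:E)%E.
Proof.
move=> hY; rewrite unlock.
rewrite (gauss_law_integral hY (f := id))//; last exact: std_affine_integrable.
have iz : N01.-integrable setT (EFin \o (fun z : R => z)).
  have := std_affine_integrable 0 1; congr (_.-integrable _ _).
  by apply/funext => z /=; rewrite add0r mul1r.
transitivity (\int[N01]_z (m%:E + s%:E * z%:E))%E.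
  by apply: eq_integral => z _; rewrite EFinD EFinM.
rewrite integralD//; last 2 first.
- exact: finite_measure_integrable_cst.
- exact: integrableZl.
rewrite integralZl// std_normal_mean mule0 adde0 integral_cst//.
by rewrite [X in (_ * X)%E](_ : _ = 1%E) ?mule1//; exact: (@probability_setT _ _ _ N01).
Qed.

Lemma gauss_law_sqr s (Y : Omega -> R) : gauss_law P 0 s Y ->
  ('E_P[fun w => (Y w ^+ 2)%R] = (s ^+ 2)%:E)%E.
Proof.
move=> hY; rewrite unlock.
have mf : measurable_fun [set: R] (fun x : R => x ^+ 2) by exact: measurable_funX.
rewrite (ge0_gauss_law_integral hY mf (@sqr_ge0 R)).
under eq_integral do rewrite add0r exprMn EFinM.
rewrite ge0_integralZl//.
- by rewrite std_normal_variance mule1.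
- by apply/measurable_EFinP; exact: measurable_funX.
- by move=> z _; rewrite lee_fin sqr_ge0.
- by rewrite lee_fin sqr_ge0.
Qed.

Lemma gauss_law_cos s (Y : Omega -> R) (t c : R) : gauss_law P 0 s Y ->
  ('E_P[fun w => cos (t * Y w + c)%R] = (cos c * expR (- ((t * s) ^+ 2) / 2))%:E)%E.
Proof.
move=> hY; rewrite unlock (gauss_law_integral hY (f := fun x => cos (t * x + c))).
- under eq_integral do rewrite add0r mulrA.
  exact: std_normal_cos.
- apply: continuous_measurable_fun => x.
  apply: continuous_comp; last exact: continuous_cos.
  by apply: cvgD; [apply: cvgM; [exact: cvg_cst|exact: cvg_id]|exact: cvg_cst].
- apply: (@std_normal_integrable _ _ 1).
    apply: continuous_measurable_fun => x.
    apply: continuous_comp; last exact: continuous_cos.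
    apply: cvgD; last exact: cvg_cst.
    apply: cvgM; first exact: cvg_cst.
    by apply: cvgD; [exact: cvg_cst|apply: cvgM; [exact: cvg_cst|exact: cvg_id]].
  move=> x; rewrite mul1r; apply: (@le_trans _ _ 1); last by rewrite lerDl sqr_ge0.
  by rewrite ler_norml cos_geN1 cos_le1.
Qed.

Lemma expectation_bounded_fin_num (Y : Omega -> R) (M : R) :
  measurable_fun setT Y -> (forall w, `|Y w| <= M) -> ('E_P[Y] \is a fin_num)%E.
Proof.
move=> mY YM; rewrite unlock; apply: integrable_fin_num => //.
apply: (@le_integrable _ _ _ P setT _ _ (cst M%:E)) => //.
- exact/measurable_EFinP.
- by move=> w _; rewrite /= lee_fin (le_trans (YM w))// ler_norm.
- exact: finite_measure_integrable_cst.
Qed.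

Lemma cvg_expectation_bounded (Yn : nat -> Omega -> R) (Y : Omega -> R)
    (f : R -> R) (M : R) :
  continuous f -> (forall x, `|f x| <= M) ->
  (forall n, measurable_fun setT (Yn n)) -> measurable_fun setT Y ->
  {ae P, forall w, (fun n => Yn n w) @ \oo --> Y w} ->
  'E_P[fun w => f (Yn n w)]%E @[n --> \oo] --> 'E_P[fun w => f (Y w)]%E.
Proof.
move=> cf fM mYn mY ae; rewrite unlock.
have mf := continuous_measurable_fun cf.
have h1 n : measurable_fun setT (fun w => (f (Yn n w))%:E).
  by apply/measurable_EFinP; exact: measurableT_comp.
have h2 : measurable_fun setT (fun w => (f (Y w))%:E).
  by apply/measurable_EFinP; exact: measurableT_comp.
have h3 : {ae P, forall w, setT w -> (fun n => (f (Yn n w))%:E) @ \oo --> (f (Y w))%:E}.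
  apply: filterS ae => w hw _; apply/fine_cvgP; split; first exact: nearW.
  by apply: continuous_cvg => //; exact: cf.
have h4 : P.-integrable setT (cst M%:E) by exact: finite_measure_integrable_cst.
have h5 : {ae P, forall w n, setT w -> (`|(f (Yn n w))%:E| <= cst M%:E w)%E}.
  by apply: aeW => w n _; rewrite lee_fin.
by have [] := dominated_convergence measurableT h1 h2 h3 h4 h5.
Qed.

Lemma gauss_law_limit (Yn : nat -> Omega -> R) (sn : nat -> R) (Y : Omega -> R) :
  (forall n, gauss_law P 0 (sn n) (Yn n)) -> measurable_fun setT Y ->
  {ae P, forall w, (fun n => Yn n w) @ \oo --> Y w} ->
  exists s, gauss_law P 0 s Y.
Proof.
move=> hYn mY ae.
have mYn n : measurable_fun setT (Yn n) by have [] := hYn n.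
have sn0 n : 0 <= sn n by have [] := hYn n.
pose chi t := fine 'E_P[fun w => cos (t * Y w)%R].
have cosE t (Z : Omega -> R) : (fun w => cos (t * Z w)) = (fun w => cos (t * Z w + 0)).
  by apply/funext => w; rewrite addr0.
have ccos t : continuous (fun x : R => cos (t * x)).
  move=> x; apply: continuous_comp; last exact: continuous_cos.
  by apply: cvgM; [exact: cvg_cst|exact: cvg_id].
have cosb (x : R) : `|cos x| <= 1 by rewrite ler_norml cos_geN1 cos_le1.
have hchi t : (fun n => expR (- ((t * sn n) ^+ 2) / 2)) @ \oo --> chi t.
  have := @cvg_expectation_bounded Yn Y (fun x => cos (t * x)) 1 (ccos t) (fun x => cosb _) mYn mY ae.
  rewrite (_ : (fun n => _) = (fun n => (expR (- ((t * sn n) ^+ 2) / 2))%:E)).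
    rewrite -(fineK (expectation_bounded_fin_num (M := 1) _ _))//; first by move/fine_cvg.
    exact: (measurableT_comp (continuous_measurable_fun (ccos t)) mY).
  by apply/funext => n; rewrite cosE (gauss_law_cos _ _ (hYn n)) cos0 mul1r.
(* A single frequency with positive limit is enough: it allows logarithms to be taken and prevents
   [sn] from escaping to infinity. It exists because [chi] tends to 1 along [1 / (k + 1)]. *)
have [t t0 chit] : exists2 t, 0 < t & 0 < chi t.
  have h : (fun k : nat => chi k.+1%:R^-1) @ \oo --> (1 : R).
    have := @cvg_expectation_bounded (fun k w => k.+1%:R^-1 * Y w) (cst 0) cos 1
      (@continuous_cos R) cosb _ _ _.
    rewrite (_ : (fun w : Omega => cos (cst 0 w)) = cst 1); last first.
      by apply/funext => w; rewrite /= cos0.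
    rewrite expectation_cst => H; apply: (fine_cvg (a := 1)); apply: H.
    - by move=> k; exact: measurable_funM.
    - exact: measurable_cst.
    - apply: aeW => w; rewrite /= -[X in _ --> X](mul0r (Y w)).
      by apply: cvgM; [exact: cvg_harmonic|exact: cvg_cst].
  have [k hk] : exists k : nat, 0 < chi k.+1%:R^-1.
    apply: (@filter_ex _ \oo); exact: (cvgr_gt _ h).
  by exists k.+1%:R^-1 => //; rewrite invr_gt0.
(* The solution [v = s^2] of [exp (- t^2 s^2 / 2) = chi t]. *)
pose v := - ln (chi t) * 2 / t ^+ 2.
have sn2 : (fun n => sn n ^+ 2) @ \oo --> v.
  rewrite (_ : (fun n => _) = (fun n => - ln (expR (- ((t * sn n) ^+ 2) / 2)) * 2 / t ^+ 2)).
    apply: cvgM; last exact: cvg_cst.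
    apply: cvgM; last exact: cvg_cst.
    apply: cvgN; apply: continuous_cvg; last exact: hchi.
    exact: continuous_ln.
  by apply/funext => n; rewrite expRK; field; exact: lt0r_neq0.
have sncvg : sn @ \oo --> Num.sqrt v.
  rewrite (_ : sn = (fun n => Num.sqrt (sn n ^+ 2))).
    by apply: continuous_cvg => //; exact: sqrt_continuous.
  by apply/funext => n; rewrite sqrtr_sqr ger0_norm.
exists (Num.sqrt v); split => //.
pose Ymix := isMeasurableFun.Build _ _ _ (measurableTypeR R) Y mY.
pose Yp : {mfun Omega >-> measurableTypeR R} := HB.pack Y Ymix.
have maff : measurable_fun setT (fun z : measurableTypeR R => 0 + Num.sqrt v * z : measurableTypeR R).
  by apply: measurable_funD => //; exact: measurable_funM.
pose affmix := isMeasurableFun.Build _ _ (measurableTypeR R) (measurableTypeR R) _ maff.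
pose affp : {mfun measurableTypeR R >-> measurableTypeR R} :=
  HB.pack (fun z : measurableTypeR R => 0 + Num.sqrt v * z : measurableTypeR R) affmix.
suff K : forall f : R -> R, continuous f -> (forall x, 0 <= f x <= 1) ->
    (\int[distribution P Yp]_x (f x)%:E = \int[distribution N01 affp]_x (f x)%:E)%E.
  by move=> A mA; exact: (@eq_probability R (distribution P Yp) (distribution N01 affp) K A mA).
move=> f cf f01.
have mf := continuous_measurable_fun cf.
have f0 x : 0 <= f x by case/andP: (f01 x).
have mf' : measurable_fun [set: measurableTypeR R] (fun x : R => (f x)%:E).
  exact/measurable_EFinP.
have E1 := @ge0_integral_distribution _ _ _ _ _ P Yp
  (fun x => (f x)%:E) mf' (fun x => f0 x : (0 <= (f x)%:E)%E).
have E2 := @ge0_integral_distribution _ _ _ _ _ N01 affp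
  (fun x => (f x)%:E) mf' (fun x => f0 x : (0 <= (f x)%:E)%E).
etransitivity; first exact: E1.
etransitivity; last (symmetry; exact: E2).
have fb x : `|f x| <= 1 by rewrite ger0_norm//; case/andP: (f01 x).
have l1 := @cvg_expectation_bounded Yn Y f 1 cf fb mYn mY ae.
rewrite unlock in l1.
(* The laws of the [Yn] are realised by [sn n * z] on one fixed space, where convergence of [sn]
   gives pointwise convergence. *)
have l2 : (\int[P]_w (f (Yn n w))%:E)%E @[n --> \oo] -->
    (\int[N01]_z (f (0 + Num.sqrt v * z))%:E)%E.
  under eq_fun do rewrite (ge0_gauss_law_integral (hYn _) mf f0).
  apply: (@dominated_cvg _ _ _ N01 _ measurableT _ _ (cst 1%E)) => //.
  - move=> n; apply/measurable_EFinP; apply: measurableT_comp => //.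
    by apply: measurable_funD => //; exact: measurable_funM.
  - move=> z _; apply/fine_cvgP; split; first exact: nearW.
    apply: continuous_cvg; first exact: cf.
    by apply: cvgD; [exact: cvg_cst|apply: cvgM; [exact: sncvg|exact: cvg_cst]].
  - exact: finite_measure_integrable_cst.
  - by move=> n z _; rewrite lee_fin.
exact: (cvg_unique _ l1 l2).
Qed.

End gauss_moments.

(** * Gaussian processes and their Volterra integrals *)

Lemma separable_dense_seq (R : realType) (V : normedModType R) :
  separable V -> exists e : nat -> V, forall (x : V) (eps : R), 0 < eps ->
    exists n, `|x - e n| < eps.
Proof.
case=> D cD dD; have [f injf] := countable_injP _ cD.
(* An index that codes no point of [D] gets the harmless value 0. *)
pose e n := xget 0 [set x | D x /\ f x = n].
exists e => x eps eps0.
have [y [xy Dy]] : ball x eps `&` D !=set0.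
  by apply: dD; [exists x; exact: ballxx|exact: ball_open].
exists (f y).
have [De fe] : [set z | D z /\ f z = f y] (e (f y)) by apply: (@xgetPex _ 0); exists y.
have -> : e (f y) = y by apply: injf; rewrite ?inE.
by move: xy; rewrite -ball_normE.
Qed.

(** * Measurability in a separable Hilbert space *)

Section hilbert_measurability.
Context (R : realType) (d : measure_display) (Omega : measurableType d).
Context (H : hilbertType R).

Lemma norm_le_dense (e : nat -> H) (y : H) (r : R) : 0 <= r ->
  (forall (x : H) (eps : R), 0 < eps -> exists n, `|x - e n| < eps) ->
  (forall n, inner y (e n) <= r * `|e n|) -> `|y| <= r.
Proof.
move=> r0 de ye; rewrite leNgt; apply/negP => ry.
have y0 : 0 < `|y| by exact: le_lt_trans ry.
(* Testing with [e n] within [eps] of [y] is contradictory as soon as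
   [|y|^2 - |y| eps > r (|y| + eps)]; this [eps] is half of the threshold. *)
pose eps := `|y| * (`|y| - r) / (`|y| + r) / 2.
have eps0 : 0 < eps by rewrite !divr_gt0 ?mulr_gt0 ?subr_gt0 ?ltr_pwDl.
have [n hn] := de y eps eps0.
have h1 := ye n.
have h2 : `|e n| <= `|y| + eps.
  rewrite -[e n](subKr y); apply: le_trans (ler_normB _ _) _.
  by rewrite lerD2l ltW.
have h3 : inner y (e n) >= `|y| ^+ 2 - `|y| * eps.
  have -> : inner y (e n) = `|y| ^+ 2 - inner y (y - e n).
    by rewrite innerBr inner_normE subKr.
  rewrite lerD2l lerN2.
  apply: le_trans (ler_norm _) _; apply: le_trans (cauchy_schwarz _ _) _.
  by rewrite ler_wpM2l// ltW.
have h4 : r * `|e n| <= r * (`|y| + eps) by rewrite ler_wpM2l.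
have h5 : eps * (`|y| + r) = `|y| * (`|y| - r) / 2.
  by rewrite /eps; field; rewrite gt_eqF// ltr_pwDl.
have h6 : 0 < `|y| * (`|y| - r) by rewrite mulr_gt0// subr_gt0.
move: h1 h3 h4 h5 h6; move: (inner y (e n)) (`|e n|) (`|y|) (eps) => a b c ee; nra.
Qed.

(** An argument of Pettis type: a closed ball is a countable intersection of half-spaces with
    normals [e k], by [norm_le_dense], and an open set is a countable union of closed balls centred
    at the [e n]. *)
Lemma hilbert_rv_weak (X : Omega -> H) : separable H ->
  (forall h, measurable_fun setT (fun w => inner (X w) h)) -> hilbert_rv X.
Proof.
move=> /separable_dense_seq[e de] mX.
apply: (@measurability _ _ Omega (g_sigma_algebraType (@open H)) setT X (@open H))
  => // _ [U oU <-]; rewrite setTI.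
have mball n (r : R) : 0 <= r -> measurable [set w | `|X w - e n| <= r].
  move=> r0.
  have -> : [set w | `|X w - e n| <= r] =
      \bigcap_k [set w | inner (X w) (e k) <= inner (e n) (e k) + r * `|e k|].
    apply/seteqP; split => w /=.
      move=> h k _ /=; rewrite -lerBlDl -innerBl.
      apply: le_trans (ler_norm _) _; apply: le_trans (cauchy_schwarz _ _) _.
      by rewrite ler_wpM2r.
    move=> h; apply: (@norm_le_dense e) => // k.
    by rewrite innerBl lerBlDl; exact: h.
  apply: bigcapT_measurable => k.
  have -> : [set w | inner (X w) (e k) <= inner (e n) (e k) + r * `|e k|] =
    (fun w => inner (X w) (e k)) @^-1` `]-oo, inner (e n) (e k) + r * `|e k|].
    by apply/seteqP; split => w /=; rewrite in_itv.
  rewrite -[X in measurable X]setTI; apply: mX => //; exact: measurable_itv.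
(* The second condition does not involve [w], so each [B n m] is a ball event or empty. *)
pose B n m := [set w | `|X w - e n| <= m.+1%:R^-1 /\
  forall y : H, `|y - e n| <= m.+1%:R^-1 -> U y].
have -> : X @^-1` U = \bigcup_n \bigcup_m B n m.
  apply/seteqP; split => w /=; last first.
    by case=> n _ [m _ [wn]]; apply.
  move=> Uw; have := oU; rewrite openE => /(_ _ Uw) /nbhs_ballP[r /= r0 rU].
  have [m hm] : exists m : nat, m.+1%:R^-1 < r / 2.
    apply: (@filter_ex _ \oo); apply: near_infty_natSinv_lt (PosNum _).
    by rewrite divr_gt0.
  have m0 : 0 < m.+1%:R^-1 :> R by rewrite invr_gt0.
  have [n hn] := de (X w) _ m0.
  exists n => //; exists m => //; split; first exact: ltW.
  move=> y hy; apply: rU; rewrite -ball_normE/=.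
  apply: le_lt_trans (ler_distD (e n) _ _) _; rewrite (distrC (e n)).
  by move: hn hy hm; set q := m.+1%:R^-1; lra.
apply: bigcupT_measurable => n; apply: bigcupT_measurable => m.
have [hU|hU] := pselect (forall y : H, `|y - e n| <= m.+1%:R^-1 -> U y).
  rewrite (_ : B n m = [set w | `|X w - e n| <= m.+1%:R^-1]); first exact: mball.
  by apply/seteqP; split => w /=; [case|].
rewrite (_ : B n m = set0) //.
by apply/seteqP; split => w //= -[].
Qed.

Context (P : probability Omega R).

Lemma full_ae (Nc : set Omega) (Q : Omega -> Prop) : measurable Nc ->
  P Nc = 1%E -> (forall w, Nc w -> Q w) -> {ae P, forall w, Q w}.
Proof.
move=> mN N1 NQ; exists (~` Nc); split; first exact: measurableC.
  have := probability_setC P mN.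
  by rewrite N1 subee.
by move=> w /= nQ Nw; apply: nQ; exact: NQ.
Qed.

(** Multiplying by the indicator of [Nc] makes the convergence hold everywhere. The limit so
    obtained agrees with [V] almost everywhere, and completeness transfers its measurability. *)
Lemma measurable_limit_full (Nc : set Omega) (Vn : nat -> Omega -> R) (V : Omega -> R) :
  measure_is_complete P -> measurable Nc -> P Nc = 1%E ->
  (forall n, measurable_fun setT (Vn n)) ->
  (forall w, Nc w -> (fun n => Vn n w) @ \oo --> V w) ->
  measurable_fun setT V.
Proof.
move=> Pc mN N1 mV VnV; apply/measurable_EFinP.
apply: (@ae_measurable_fun _ _ _ P Pc setT (EFin \o (fun w => V w * \1_Nc w))).
  apply: full_ae mN N1 _ => w Nw _ /=; rewrite indicE mem_set// mulr1//.
apply/measurable_EFinP.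
apply: (@measurable_fun_cvg _ _ _ _ (fun n w => Vn n w * \1_Nc w)).
  by move=> n; apply: measurable_funM => //; exact: measurable_indic.
move=> w _; rewrite indicE; case: (boolP (w \in Nc)) => [|_].
  by rewrite inE => Nw; apply: cvgM; [exact: VnV|exact: cvg_cst].
by rewrite mulr0; under eq_fun do rewrite mulr0; exact: cvg_cst.
Qed.

End hilbert_measurability.

(** * Linear combinations of values of the process and their covariances *)

Section gaussian_process_combinations.
Context (R : realType) (d : measure_display) (Omega : measurableType d).
Context (P : probability Omega R) (H : hilbertType R).
Context (T : R) (W : R -> Omega -> H) (Q : R -> R -> boundedOp H).

Definition process_comb (l : seq (R * H)) (w : Omega) : R :=
  \sum_(p <- l) inner (W p.1 w) p.2.

Definition times_in (l : seq (R * H)) := forall p, p \in l -> 0 <= p.1 <= T.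

(** The linear space spanned by the variables [<W t, h>]. Tested Riemann sums belong to it, and the
    process hypotheses make each of its elements a centered Gaussian. *)
Definition is_comb (Z : Omega -> R) :=
  exists2 l, times_in l & Z = process_comb l.

Lemma is_comb_inner t h : 0 <= t <= T -> is_comb (fun w => inner (W t w) h).
Proof.
move=> tT; exists [:: (t, h)]; first by move=> p; rewrite inE => /eqP ->.
by apply/funext => w; rewrite /process_comb big_seq1.
Qed.

Lemma is_comb0 : is_comb (fun=> 0).
Proof. by exists [::] => //; apply/funext => w; rewrite /process_comb big_nil. Qed.

Lemma is_combD Z Z' : is_comb Z -> is_comb Z' -> is_comb (fun w => Z w + Z' w).
Proof.
move=> [l lT ->] [l' l'T ->]; exists (l ++ l').
  by move=> p; rewrite mem_cat => /orP[/lT|/l'T].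
by apply/funext => w; rewrite /process_comb big_cat.
Qed.

Lemma is_combN Z : is_comb Z -> is_comb (fun w => - Z w).
Proof.
move=> [l lT ->]; exists [seq (p.1, - p.2) | p <- l].
  by move=> _ /mapP[p pl ->]; exact: (lT p).
apply/funext => w; rewrite /process_comb big_map -sumrN.
by apply: eq_bigr => p _ /=; rewrite innerNr.
Qed.

Lemma is_comb_sum I (r : seq I) (p : pred I) (Z : I -> Omega -> R) :
  (forall i, is_comb (Z i)) -> is_comb (fun w => \sum_(i <- r | p i) Z i w).
Proof.
move=> hZ; elim: r => [|i r IH].
  by under eq_fun do rewrite big_nil; exact: is_comb0.
have [pi|pi] := boolP (p i).
  by under eq_fun do rewrite big_cons pi; exact: is_combD.
by under eq_fun do rewrite big_cons (negbTE pi).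
Qed.

Context (Wgauss : gaussian_process P `[0, T] W).
Context (Wmean : zero_mean P `[0, T] W).
Context (Wcov : covariance_operator P `[0, T] W Q).

Lemma is_comb_real_gaussian Z : is_comb Z -> real_gaussian P Z.
Proof.
move=> [l lT ->].
have ht i : `[0, T]%classic (tnth (in_tuple l) i).1.
  by rewrite /= in_itv/=; apply: lT; exact: mem_tnth.
have [_] := Wgauss ht.
move=> /(_ (fun i => (tnth (in_tuple l) i).2)); congr (real_gaussian _ _).
by apply/funext => w; rewrite /process_comb [RHS]big_tnth.
Qed.

Lemma is_comb_law Z : is_comb Z -> exists m s, gauss_law P m s Z.
Proof. by move=> /is_comb_real_gaussian/real_gaussianP. Qed.

Lemma is_comb_measurable Z : is_comb Z -> measurable_fun setT Z.
Proof. by move=> /is_comb_law[m [s []]]. Qed.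

Lemma is_combM_integrable Z Z' : is_comb Z -> is_comb Z' ->
  P.-integrable setT (EFin \o (fun w => Z w * Z' w)).
Proof.
move=> hZ hZ'; have [m [s law]] := is_comb_law hZ.
have [m' [s' law']] := is_comb_law hZ'.
apply: (@le_integrable _ _ _ P setT _ _ (fun w => (Z w ^+ 2)%:E + (Z' w ^+ 2)%:E)%E) => //.
- by apply/measurable_EFinP; apply: measurable_funM; exact: is_comb_measurable.
- move=> w _; rewrite -EFinD /= lee_fin [leRHS]ger0_norm ?addr_ge0 ?sqr_ge0//.
  rewrite normrM -[Z w ^+ 2]real_normK ?num_real// -[Z' w ^+ 2]real_normK ?num_real//.
  have := sqr_ge0 (`|Z w| - `|Z' w|); have : 0 <= `|Z w| * `|Z' w| by rewrite mulr_ge0.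
  rewrite sqrrB; lra.
- by apply: integrableD => //; [exact: gauss_law_sqr_integrable law|
    exact: gauss_law_sqr_integrable law'].
Qed.

Lemma is_comb_integrable Z : is_comb Z -> P.-integrable setT (EFin \o Z).
Proof.
move=> hZ; have [m [s law]] := is_comb_law hZ.
apply: (gauss_law_integrable law (f := id)) => //; exact: std_affine_integrable.
Qed.

Lemma is_comb_mean Z : is_comb Z -> ('E_P[Z] = 0)%E.
Proof.
move=> [l lT ->]; elim: l lT => [|p l IH] lT.
  rewrite (_ : process_comb _ = cst 0) ?expectation_cst//.
  by apply/funext => w; rewrite /process_comb big_nil.
have pT : 0 <= p.1 <= T by apply: lT; rewrite mem_head.
have lT' : times_in l by move=> q ql; apply: lT; rewrite inE ql orbT.
rewrite (_ : process_comb _ = (fun w => inner (W p.1 w) p.2) \+ process_comb l); last first.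
  by apply/funext => w; rewrite /process_comb big_cons.
rewrite expectationD ?IH ?adde0 ?Wmean//.
- by apply/Lfun1_integrable/is_comb_integrable/is_comb_inner.
- by apply/Lfun1_integrable/is_comb_integrable; exists l.
Qed.

Lemma is_comb_centered Z : is_comb Z -> exists s, gauss_law P 0 s Z.
Proof.
move=> hZ; have [m [s law]] := is_comb_law hZ.
have := gauss_law_mean law; rewrite (is_comb_mean hZ) => -[m0].
by exists s; rewrite m0.
Qed.

(* Meaningful only for square integrable arguments. *)
Definition cov (Z Z' : Omega -> R) : R := (\int[P]_w (Z w * Z' w))%R.

Lemma covC Z Z' : cov Z Z' = cov Z' Z.
Proof. by apply: eq_Rintegral => w _; rewrite mulrC. Qed.

Lemma covDl Z1 Z2 Z' : is_comb Z1 -> is_comb Z2 -> is_comb Z' ->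
  cov (fun w => Z1 w + Z2 w) Z' = cov Z1 Z' + cov Z2 Z'.
Proof.
move=> h1 h2 h'; rewrite /cov -RintegralD//; try exact: is_combM_integrable.
by apply: eq_Rintegral => w _; rewrite mulrDl.
Qed.

Lemma covNl Z Z' : is_comb Z -> is_comb Z' -> cov (fun w => - Z w) Z' = - cov Z Z'.
Proof.
move=> h h'; rewrite /cov -mulN1r -RintegralZl//; last exact: is_combM_integrable.
by apply: eq_Rintegral => w _; rewrite mulNr mulN1r.
Qed.

Lemma cov_suml I (r : seq I) (p : pred I) (Z : I -> Omega -> R) Z' :
  (forall i, is_comb (Z i)) -> is_comb Z' ->
  cov (fun w => \sum_(i <- r | p i) Z i w) Z' = \sum_(i <- r | p i) cov (Z i) Z'.
Proof.
move=> hZ h'; elim: r => [|i r IH].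
  rewrite big_nil /cov; under eq_Rintegral do rewrite big_nil mul0r.
  by rewrite Rintegral_cst// mul0r.
rewrite big_cons -IH; case: ifPn => pi.
  rewrite -covDl//; last exact: is_comb_sum.
  by congr cov; apply/funext => w; rewrite big_cons pi.
by congr cov; apply/funext => w; rewrite big_cons (negbTE pi).
Qed.

Lemma cov_inner s t g h : 0 <= s <= T -> 0 <= t <= T ->
  cov (fun w => inner (W t w) g) (fun w => inner (W s w) h) = inner (Q s t g) h.
Proof.
move=> sT tT; have sI : `[0, T]%classic s by rewrite /= in_itv.
have tI : `[0, T]%classic t by rewrite /= in_itv.
by rewrite /cov /Rintegral -[RHS]/(fine (inner (Q s t g) h)%:E) (Wcov g h sI tI) unlock.
Qed.

(** The times of the second factor come first in [rect_incr], because [Q s t] pairs its argument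
    with [W t] and its value with [W s]. *)
Lemma cov_increments u v u' v' g g' : 0 <= u <= T -> 0 <= v <= T ->
  0 <= u' <= T -> 0 <= v' <= T ->
  cov (fun w => inner (W v w - W u w) g) (fun w => inner (W v' w - W u' w) g') =
  inner (rect_incr Q u' u v' v g) g'.
Proof.
move=> uT vT u'T v'T.
have E a b x : (fun w => inner (W b w - W a w) x) =
    (fun w => inner (W b w) x + (- inner (W a w) x)).
  by apply/funext => w; rewrite innerBl.
have hI t h : 0 <= t <= T -> is_comb (fun w => inner (W t w) h) by exact: is_comb_inner.
have hNI t h : 0 <= t <= T -> is_comb (fun w => - inner (W t w) h).
  by move=> tT; apply: is_combN; exact: hI.
have hB : is_comb (fun w => inner (W v' w) g' + - inner (W u' w) g').
  by apply: is_combD; [exact: hI|exact: hNI].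
rewrite !E covDl//; [|exact: hI|exact: hNI].
rewrite covNl//; last exact: hI.
rewrite ![cov _ (fun w => _ + _)]covC !covDl//; try exact: hI; try exact: hNI.
rewrite !covNl//; try exact: hI.
rewrite ![cov (fun w => inner (W v' w) g') _]covC ![cov (fun w => inner (W u' w) g') _]covC.
rewrite !cov_inner//.
rewrite (_ : rect_incr Q u' u v' v g = Q v' v g - Q v' u g - Q u' v g + Q u' u g)//.
by rewrite innerDl !innerBl opprD opprK; ring.
Qed.

Lemma is_comb_sqr Z s : is_comb Z -> gauss_law P 0 s Z -> s ^+ 2 = cov Z Z.
Proof.
move=> hZ law; have := gauss_law_sqr law; rewrite unlock => e.
rewrite /cov /Rintegral -[LHS]/(fine (s ^+ 2)%:E) -e; congr fine.
Qed.

Context (K : R -> R -> boundedOp H).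

Lemma inner_volterra_sum tau s w h :
  inner (volterra_sum K (W ^~ w) tau s) h =
  \sum_(i < size s) inner (W (node s i.+1) w - W (node s i) w) (adjoint (K tau (node s i)) h).
Proof.
by rewrite /volterra_sum inner_suml; apply: eq_bigr => i _; rewrite adjointP.
Qed.

Lemma node_itv t s i : itv_partition 0 t s -> t <= T -> (i <= size s)%N ->
  0 <= node s i <= T.
Proof.
move=> ps tT; have T0 : 0 <= T by exact: le_trans (itv_partition_le ps) tT.
case: i => [|i] si; first by rewrite /node /= lexx.
have : node s i.+1 \in s by rewrite /node /= mem_nth.
by move=> /(partition_itv ps)/andP[/ltW -> /le_trans ->].
Qed.

Lemma is_comb_increment u v h : 0 <= u <= T -> 0 <= v <= T ->
  is_comb (fun w => inner (W v w - W u w) h).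
Proof.
move=> uT vT; under eq_fun do rewrite innerBl.
by apply: is_combD; [|apply: is_combN]; exact: is_comb_inner.
Qed.

Lemma is_comb_volterra_sum t tau s h : itv_partition 0 t s -> t <= T ->
  is_comb (fun w => inner (volterra_sum K (W ^~ w) tau s) h).
Proof.
move=> ps tT; under eq_fun do rewrite inner_volterra_sum.
apply: is_comb_sum => i; apply: is_comb_increment; apply: (node_itv ps) => //.
exact: ltnW.
Qed.

Lemma cov_volterra_sum t tau s h : itv_partition 0 t s -> t <= T ->
  cov (fun w => inner (volterra_sum K (W ^~ w) tau s) h)
      (fun w => inner (volterra_sum K (W ^~ w) tau s) h) =
  inner (double_sum K Q tau s s h) h.
Proof.
move=> ps tT.
have nT (i : 'I_(size s)) : 0 <= node s i <= T by apply: (node_itv ps) => //; exact: ltnW.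
have nT' (i : 'I_(size s)) : 0 <= node s i.+1 <= T by exact: (node_itv ps).
under [X in cov X _]eq_fun do rewrite inner_volterra_sum.
rewrite cov_suml; last 2 first.
- by move=> i; exact: is_comb_increment.
- exact: is_comb_volterra_sum ps tT.
under eq_bigr => i _.
  (* After the exchange the outer index [i] sits in the second factor, as in [double_sum], where it
     belongs to the left kernel and to the first variable of [Q]. *)
  rewrite covC.
  under [X in cov X _]eq_fun do rewrite inner_volterra_sum.
  rewrite cov_suml; last 2 first.
  - by move=> j; exact: is_comb_increment.
  - exact: is_comb_increment.
  over.
rewrite /double_sum sum_boundedOpE inner_suml; apply: eq_bigr => i _.
rewrite sum_boundedOpE inner_suml; apply: eq_bigr => j _.
by rewrite cov_increments//= adjointP.
Qed.

End gaussian_process_combinations.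

(** * The Volterra process as a limit of Gaussian variables *)

Section volterra_process.
Context (R : realType) (d : measure_display) (Omega : measurableType d).
Context (P : probability Omega R) (Pcomplete : measure_is_complete P).
Context (H : hilbertType R) (Hsep : separable H) (T : R) (T0 : 0 < T).
Context (alpha beta eta : R) (eta0 : 0 < eta) (eta_beta : eta < beta)
  (eta_alpha : eta < alpha).
Context (W : R -> Omega -> H) (Q : R -> R -> boundedOp H).
Context (Wgauss : gaussian_process P `[0, T] W) (Wmean : zero_mean P `[0, T] W)
  (Wcov : covariance_operator P `[0, T] W Q).
Context (Nc : set Omega) (Nc_meas : measurable Nc) (Nc_full : P Nc = 1%E)
  (W_hoelder : forall w, Nc w -> hoelder_on beta `[0, T] (W ^~ w)).
Context (K : R -> R -> boundedOp H) (HK : kernel_class T eta K)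
  (HQ : covariance_class T alpha Q).
Context (X : R -> R -> Omega -> H)
  (HX : forall w tau t, Nc w -> 0 <= t -> t <= tau -> tau <= T ->
      X tau t w = volterra_integral K (W ^~ w) tau t).

Let Vn tau t h n w := inner (volterra_sum K (W ^~ w) tau (uniform_partition t n)) h.

Let Vn_comb tau t h n : 0 <= t -> t <= T -> is_comb T W (Vn tau t h n).
Proof.
move=> t0 tT; have [pn _] := uniform_partitionP n t0.
exact: is_comb_volterra_sum pn tT.
Qed.

Let Vn_cvg tau t h w : Nc w -> 0 <= t -> t <= tau -> tau <= T ->
  (fun n => Vn tau t h n w) @ \oo --> inner (X tau t w) h.
Proof.
move=> Nw t0 t_tau tauT; apply: cvg_inner; rewrite HX//.
apply: cvg_comp (cvg_uniform_partition t0) _.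
exact: (volterra_cvg T0 HK eta0 eta_beta (W_hoelder Nw) t0 t_tau tauT).
Qed.

Lemma volterra_measurable tau t h : 0 <= t -> t <= tau -> tau <= T ->
  measurable_fun setT (fun w => inner (X tau t w) h).
Proof.
move=> t0 t_tau tauT; have tT := le_trans t_tau tauT.
apply: (measurable_limit_full Pcomplete Nc_meas Nc_full (Vn := Vn tau t h)).
- by move=> n; apply: (is_comb_measurable Wgauss); exact: Vn_comb.
- by move=> w Nw; exact: Vn_cvg.
Qed.

Lemma volterra_hilbert_rv tau t : 0 <= t -> t <= tau -> tau <= T ->
  hilbert_rv (X tau t).
Proof.
by move=> *; apply: hilbert_rv_weak => // h; exact: volterra_measurable.
Qed.

(** Riemann sums at several times, tested and added, still form one combination of values of [W];
    hence the limits are jointly Gaussian, and centered as the case [n = 1] records. *)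
Lemma volterra_sum_law n (t : 'I_n -> R) (h : 'I_n -> H) :
  (forall i, `[0, T]%classic (t i)) ->
  exists s, gauss_law P 0 s (fun w => \sum_(i < n) inner (X (t i) (t i) w) (h i)).
Proof.
move=> tI; have t0 i : 0 <= t i by have := tI i; rewrite /= in_itv/= => /andP[].
have tT i : t i <= T by have := tI i; rewrite /= in_itv/= => /andP[].
pose Z k w := \sum_(i < n) Vn (t i) (t i) (h i) k w.
have Zc k : is_comb T W (Z k) by apply: is_comb_sum => i; exact: Vn_comb.
have /choice[s sP] k := is_comb_centered Wgauss Wmean (Zc k).
apply: (gauss_law_limit sP).
  apply: measurable_sum => i; exact: volterra_measurable.
apply: full_ae Nc_meas Nc_full _ => w Nw.
have hc i : (fun k => Vn (t i) (t i) (h i) k w) @ \oo --> inner (X (t i) (t i) w) (h i) by exact: Vn_cvg.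
apply: (@cvg_big R 'I_n +%R 0 xpredT _ nat \oo _ (fun i k => Vn (t i) (t i) (h i) k w)) => //.
exact: add_continuous.
Qed.

Lemma volterra_gaussian_process : gaussian_process P `[0, T] (fun t => X t t).
Proof.
move=> n t tI; split=> [i|h].
  by have := tI i; rewrite /= in_itv/= => /andP[? ?]; exact: volterra_hilbert_rv.
by apply/real_gaussianP; exists 0; exact: volterra_sum_law.
Qed.

Lemma volterra_zero_mean : zero_mean P `[0, T] (fun t => X t t).
Proof.
move=> t h tI; have [s] := @volterra_sum_law 1 (fun=> t) (fun=> h) (fun=> tI).
under [X in gauss_law _ _ _ X]eq_fun do rewrite big_ord1.
exact: gauss_law_mean.
Qed.

(** The expectations for the Riemann sums converge in two ways: [l1] through their variances, [l2]
    through the almost sure convergence of the sums. The phase [c] covers cosine and sine. *)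
Lemma volterra_cos tau t f c : 0 <= t -> t <= tau -> tau <= T ->
  ('E_P[fun w => cos (inner (X tau t w) f + c)%R] =
   (cos c * expR (- (1 / 2 * inner (double_integral K Q tau t f) f)))%:E)%E.
Proof.
move=> t0 t_tau tauT; have tT := le_trans t_tau tauT.
have /choice[s sP] n := is_comb_centered Wgauss Wmean (Vn_comb tau f n t0 tT).
have sq : (fun n => s n ^+ 2) @ \oo --> inner (double_integral K Q tau t f) f.
  rewrite (_ : (fun n => _) = (fun n =>
    inner (double_sum K Q tau (uniform_partition t n) (uniform_partition t n) f) f)).
    have FF := mesh_to0_proper t0.
    apply: cvg_inner.
    have D : (fun n => double_sum K Q tau (uniform_partition t n) (uniform_partition t n))
        @ \oo --> double_integral K Q tau t.
      (* The double limit lets both meshes vary independently, so it may be taken along equal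
         partitions, where the double sum is a variance. *)
      have hp : (fun n => (uniform_partition t n, uniform_partition t n)) @ \oo -->
          (mesh_to0 t, mesh_to0 t).
        by apply: cvg_pair; exact: cvg_uniform_partition.
      exact: (cvg_comp _ _ hp (double_cvg T0 HK eta0 eta_alpha HQ t0 t_tau tauT)).
    exact: cvg_boundedOp.
  apply/funext => n; have [pn _] := uniform_partitionP n t0.
  rewrite (is_comb_sqr (Vn_comb tau f n t0 tT) (sP n)).
  exact: (cov_volterra_sum Wgauss Wcov K tau f pn tT).
have l1 : 'E_P[fun w => cos (Vn tau t f n w + c)%R]%E @[n --> \oo] -->
    (cos c * expR (- (1 / 2 * inner (double_integral K Q tau t f) f)))%:E.
  rewrite (_ : (fun n => _) = (fun n => (cos c * expR (- (1 / 2 * s n ^+ 2)))%:E)).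
    apply/fine_cvgP; split; first exact: nearW.
    apply: cvgM; first exact: cvg_cst.
    apply: continuous_cvg; first exact: continuous_expR.
    by apply: cvgN; apply: cvgM; [exact: cvg_cst|exact: sq].
  apply/funext => n.
  transitivity ('E_P[fun w => cos (1 * Vn tau t f n w + c)%R])%E.
    by congr expectation; apply/funext => w; rewrite mul1r.
  by rewrite (gauss_law_cos _ _ (sP n)) mul1r; congr (_ * expR _)%:E; lra.
have l2 : 'E_P[fun w => cos (Vn tau t f n w + c)%R]%E @[n --> \oo] -->
    'E_P[fun w => cos (inner (X tau t w) f + c)%R]%E.
  apply: (@cvg_expectation_bounded _ _ _ P (Vn tau t f)
    (fun w => inner (X tau t w) f) (fun x => cos (x + c)) 1).
  - move=> x; apply: continuous_comp; last exact: continuous_cos.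
    by apply: cvgD; [exact: cvg_id|exact: cvg_cst].
  - by move=> x; rewrite ler_norml cos_geN1 cos_le1.
  - by move=> n; apply: (is_comb_measurable Wgauss); exact: Vn_comb.
  - exact: volterra_measurable.
  - by apply: full_ae Nc_meas Nc_full _ => w Nw; exact: Vn_cvg.
exact: (cvg_unique _ l2 l1).
Qed.

Lemma volterra_characteristic tau t f : 0 <= t -> t <= tau -> tau <= T ->
  cexpectation P (fun w => cexp ('i%C * (inner (X tau t w) f)%:C%C)) =
  cexp (- (1 / 2 * inner (double_integral K Q tau t f) f))%:C%C.
Proof.
move=> t0 t_tau tauT.
have E (y : R) : cexp ('i%C * y%:C%C) = (cos y +i* sin y)%C.
  by rewrite /cexp /=; simpc; rewrite expR0 !mul1r.
have hcos : ('E_P[fun w => cos (inner (X tau t w) f)] =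
    (expR (- (1 / 2 * inner (double_integral K Q tau t f) f)))%:E)%E.
  have := volterra_cos f 0 t0 t_tau tauT; rewrite cos0 mul1r => <-.
  by congr expectation; apply/funext => w; rewrite addr0.
have hsin : ('E_P[fun w => sin (inner (X tau t w) f)] = 0)%E.
  (* The phase [- pi / 2] turns the cosine into a sine, and its own cosine makes the right-hand side
     vanish. *)
  have := volterra_cos f (- (pi / 2)) t0 t_tau tauT.
  rewrite cosN cos_pihalf mul0r => e; rewrite -[RHS]/(0%:E) -e.
  by congr expectation; apply/funext => w; rewrite cosB cos_pihalf sin_pihalf mulr0 add0r mulr1.
transitivity ((fine 'E_P[fun w => cos (inner (X tau t w) f)] +i*
    fine 'E_P[fun w => sin (inner (X tau t w) f)])%C)%E.
  by rewrite /cexpectation; congr Complex; congr fine; congr expectation;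
    apply/funext => w; rewrite E.
by rewrite hcos hsin /cexp /=; simpc; rewrite cos0 sin0 mulr1 mulr0.
Qed.

End volterra_process.

Theorem proposition22 (R : realType) (d : measure_display)
    (Omega : measurableType d) (P : probability Omega R)
    (Pcomplete : measure_is_complete P)
    (H : hilbertType R) (Hsep : separable H)
    (T : R) (T0 : 0 < T)
    (alpha beta eta : R)
    (alpha01 : 0 < alpha < 1) (beta01 : 0 < beta < 1) (eta01 : 0 < eta < 1)
    (beta_eta : 0 < beta - eta) (alpha_eta : 0 < alpha - eta)
    (W : R -> Omega -> H) (QW : R -> R -> boundedOp H)
    (Wgauss : gaussian_process P `[0, T] W)
    (Wmean : zero_mean P `[0, T] W)
    (Wcov : covariance_operator P `[0, T] W QW)
    (Nc : set Omega) (Nc_meas : measurable Nc) (Nc_full : P Nc = 1%E)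
    (W_hoelder : forall w, Nc w -> hoelder_on beta `[0, T] (W ^~ w))
    (K : R -> R -> boundedOp H) (HK : kernel_class T eta K)
    (HQ : covariance_class T alpha QW)
    (X : R -> R -> Omega -> H)
    (HX : forall w tau t, Nc w -> 0 <= t -> t <= tau -> tau <= T ->
      X tau t w = volterra_integral K (W ^~ w) tau t) :
  [/\ gaussian_process P `[0, T] (fun t => X t t),
      zero_mean P `[0, T] (fun t => X t t) &
      forall (tau t : R) (f : H), 0 <= t -> t <= tau -> tau <= T ->
        hilbert_rv (X tau t) /\
        cexpectation P (fun w => cexp ('i%C * (inner (X tau t w) f)%:C%C)) =
        cexp (- (1 / 2 * inner (double_integral K QW tau t f) f))%:C%C].
Proof.
have eta0 : 0 < eta by case/andP: eta01.
have eb : eta < beta by rewrite -subr_gt0.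
have ea : eta < alpha by rewrite -subr_gt0.
split.
- exact: (@volterra_gaussian_process _ _ _ P Pcomplete _ Hsep T T0 beta eta eta0 eb W
    Wgauss Wmean Nc Nc_meas Nc_full W_hoelder K HK X HX).
- exact: (@volterra_zero_mean _ _ _ P Pcomplete _ T T0 beta eta eta0 eb W
    Wgauss Wmean Nc Nc_meas Nc_full W_hoelder K HK X HX).
- move=> tau t f t0 t_tau tauT; split.
    exact: (@volterra_hilbert_rv _ _ _ P Pcomplete _ Hsep T T0 beta eta eta0 eb W
      Wgauss Nc Nc_meas Nc_full W_hoelder K HK X HX).
  exact: (@volterra_characteristic _ _ _ P Pcomplete _ T T0 alpha beta eta eta0 eb ea W QW
    Wgauss Wmean Wcov Nc Nc_meas Nc_full W_hoelder K HK HQ X HX).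
Qed.
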